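(* Let $0<\alpha\le1$, $1\le p\le\infty$, $b$ a prime, $m\ge1$, $N=b^m$, and $1\le s<N$. Let $R_{N,s}=\{\boldsymbol{z}_0,\dots,\boldsymbol{z}_{N-1}\}$ with $\boldsymbol{z}_n$ as in the context. Then $$\mathrm{e}(W_{\alpha,p},R_{N,s})\le\max\Big(\frac{b(s-1)+1}{(b-1)\sqrt N},\frac{s^{\alpha/p}}{N^\alpha}\Big).$$
   Context: $s^{\alpha/p}=1$ if $p=\infty$. $\mathbb{F}_{b^m}$ is the field with $b^m$ elements, $\mathbb{Z}_{b^m}=\{0,\dots,b^m-1\}$; $\psi$ a fixed non-trivial additive character of $\mathbb{F}_{b^m}$; $\varphi,\mu:\mathbb{Z}_{b^m}\to\mathbb{F}_{b^m}$ fixed bijections with $\varphi(0)=\mu(0)=0$. For $x=\sum_{i\ge1}\xi_ib^{-mi}\in[0,1)$ (finite expansion for $b^m$-adic rationals) and $k=\sum_{i=0}^{a-1}\kappa_ib^{mi}\in\mathbb{N}_0$, $\mathrm{wal}_k(x)=\prod_{i=1}^a\psi(\mu(\kappa_{i-1})\varphi(\xi_i))$; $\mathrm{wal}_{\boldsymbol{k}}(\boldsymbol{x})=\prod_j\mathrm{wal}_{k_j}(x_j)$. Walsh coefficients $\widehat h(\boldsymbol{k})=\int_{[0,1]^s}h\,\overline{\mathrm{wal}_{\boldsymbol{k}}}$. $|h|_{H_{\alpha,p}}=\sup\{|h(\boldsymbol{x}+\boldsymbol{h})-h(\boldsymbol{x})|/\|\boldsymbol{h}\|_{\ell^p}^\alpha:\boldsymbol{h}\ne\boldsymbol{0},\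 \boldsymbol{x},\boldsymbol{x}+\boldsymbol{h}\in[0,1)^s\}$. $W_{\alpha,p}$: real $h\in L^2([0,1]^s)$ with $\|h\|_{W_{\alpha,p}}=\sum_{\boldsymbol{k}\in\mathbb{N}_0^s}|\widehat h(\boldsymbol{k})|+|h|_{H_{\alpha,p}}<\infty$. Let $c_1<c_2<\cdots$ enumerate the positive integers not divisible by $b$. $\boldsymbol{z}_n=\big(\varphi^{-1}[\varphi(n)^{c_1}]/b^m,\dots,\varphi^{-1}[\varphi(n)^{c_s}]/b^m\big)$ for $n\in\mathbb{Z}_{b^m}$, powers in $\mathbb{F}_{b^m}$. Worst-case error $\mathrm{e}(B,U)=\sup_{\|h\|_B\le1}|\int_{[0,1]^s}h-\frac1{|U|}\sum_{\boldsymbol{x}\in U}h(\boldsymbol{x})|$, points counted with multiplicity. *)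

(* Defs.v *)
From Stdlib Require Import Reals ClassicalEpsilon.
From HB Require Import structures.
From mathcomp Require Import all_boot all_order all_algebra all_field.
Set Implicit Arguments. Unset Strict Implicit. Unset Printing Implicit Defensive.

Local Open Scope R_scope.

Definition Cplx := (R * R)%type.
Definition C0 : Cplx := (0, 0).
Definition C1 : Cplx := (1, 0).
Definition Cmul (z w : Cplx) : Cplx :=
  (fst z * fst w - snd z * snd w, fst z * snd w + snd z * fst w).
Definition Cmod (z : Cplx) : R := sqrt (fst z * fst z + snd z * snd z).

Inductive pexp := PFin of R | PInf.
Definition pexp_ok (p : pexp) : Prop :=
  match p with PFin q => 1 <= q | PInf => True end.

(* x^q for x >= 0, with 0^q = 0 (q > 0) *)
Definition Rpow0 (x q : R) : R :=
  if Req_EM_T x 0 then 0 else Rpower x q.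

Definition lpnorm (p : pexp) (s : nat) (d : 'I_s -> R) : R :=
  match p with
  | PFin q => Rpow0 (\big[Rplus/0]_(j < s) Rpow0 (Rabs (d j)) q) (/ q)
  | PInf => \big[Rmax/0]_(j < s) Rabs (d j)
  end.

Definition s_pow (p : pexp) (alpha : R) (s : nat) : R :=
  match p with PFin q => Rpower (INR s) (alpha / q) | PInf => 1 end.

Definition riemann_sum (s : nat) (f : ('I_s -> R) -> R) (n : nat) : R :=
  (\big[Rplus/0]_(g : {ffun 'I_s -> 'I_n.+1})
      f (fun j => INR (nat_of_ord (g j)) / INR n.+1)) / (INR n.+1 ^ s).

Definition integral (s : nat) (f : ('I_s -> R) -> R) : R :=
  epsilon (inhabits 0) (fun I => Un_cv (riemann_sum f) I).

Section Walsh.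
Variables (F : finFieldType) (N : nat) (psi : F -> Cplx) (phi mu : nat -> F).

(* i-th base-N digit xi_i of x = sum_{i>=1} xi_i N^{-i} (finite expansion) *)
Definition xdigit (x : R) (i : nat) : nat :=
  (Z.to_nat (Int_part (x * pow (INR N) i)) %% N)%N.

Definition kdigit (k i : nat) : nat := ((k %/ N ^ i) %% N)%N.

(* number a of base-N digits of k (a = 0 for k = 0) *)
Definition ndigits (k : nat) : nat := up_log N k.+1.

Definition wal1 (k : nat) (x : R) : Cplx :=
  \big[Cmul/C1]_(1 <= i < (ndigits k).+1)
     psi (GRing.mul (mu (kdigit k i.-1)) (phi (xdigit x i))).

Definition walsh (s : nat) (k : 'I_s -> nat) (x : 'I_s -> R) : Cplx :=
  \big[Cmul/C1]_(j < s) wal1 (k j) (x j).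

(* |hat h(k)| where hat h(k) = int h * conj(wal_k) *)
Definition walsh_coef_abs (s : nat) (h : ('I_s -> R) -> R) (k : 'I_s -> nat) : R :=
  let re := integral (fun x => h x * fst (walsh k x)) in
  let im := integral (fun x => - (h x * snd (walsh k x))) in
  sqrt (re * re + im * im).

Definition walsh_partial_sum (s : nat) (h : ('I_s -> R) -> R) (K : nat) : R :=
  \big[Rplus/0]_(g : {ffun 'I_s -> 'I_K})
     walsh_coef_abs h (fun j => nat_of_ord (g j)).
End Walsh.

Definition in_unit_cube (s : nat) (x : 'I_s -> R) : Prop :=
  forall j, 0 <= x j < 1.

(* ||h||_{W_{alpha,p}} <= 1, i.e.
   sum_k |hat h(k)| + |h|_{H_{alpha,p}} <= 1, written as: every partial sum of
   the (nonnegative) Walsh series plus every Hoelder quotient is <= 1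
   (equivalent to sup + sup <= 1). *)
Definition in_W_unit_ball (F : finFieldType) (N : nat) (psi : F -> Cplx)
    (phi mu : nat -> F) (alpha : R) (p : pexp) (s : nat)
    (h : ('I_s -> R) -> R) : Prop :=
  forall (K : nat) (x d : 'I_s -> R),
    in_unit_cube x -> in_unit_cube (fun j => x j + d j) ->
    (exists j, d j <> 0) ->
    walsh_partial_sum N psi phi mu h K
      + Rabs (h (fun j => x j + d j) - h x) / Rpow0 (lpnorm p d) alpha <= 1.

(* c_1 < c_2 < ... : the positive integers not divisible by b; cexp b j = c_{j+1} *)
Definition cexp (b j : nat) : nat :=
  (nth 0 [seq i <- iota 1 (b * j.+1) | ~~ (b %| i)] j)%N.

Definition zpoint (F : finFieldType) (N b : nat) (phi : nat -> F) (phiinv : F -> nat)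
    (s : nat) (n : nat) : 'I_s -> R :=
  fun j => INR (phiinv (GRing.exp (phi n) (cexp b (nat_of_ord j)))) / INR N.

Definition qmc (F : finFieldType) (N b : nat) (phi : nat -> F) (phiinv : F -> nat)
    (s : nat) (h : ('I_s -> R) -> R) : R :=
  (\big[Rplus/0]_(n < N) h (zpoint N b phi phiinv (s:=s) n)) / INR N.

Definition nontrivial_additive_char (F : finFieldType) (psi : F -> Cplx) : Prop :=
  (forall x y : F, psi (GRing.add x y) = Cmul (psi x) (psi y)) /\
  (forall x : F, psi x <> C0) /\
  (exists x : F, psi x <> C1).

(* Main.v *)
Require Import Defs.
From Stdlib Require Import ZArith Reals Lra ClassicalEpsilon FunctionalExtensionality.
From HB Require Import structures.
From mathcomp Require Import all_boot all_order all_algebra all_field.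
From mathcomp Require Import Rstruct.

(** On a cell of the [b^m]-adic grid, [h] differs from its mean by at most its
    Hoelder seminorm times [s^(alpha/p) / N^alpha]. The function of cell means
    is a combination of the [wal_k] with [k_j < N], whose coefficients are the
    Walsh coefficients of [h]; on the point set each such [wal_k], [k <> 0],
    averages to [N^-1 \sum_x psi (f x)] with [deg f = c_j] prime to [b], so Weil's
    bound [(c_j - 1) sqrt N] applies. As the two norms add up to at most [1],
    the error is at most the maximum of the two bounds.

    Weil's bound is proved inside [F[X]]. The L-function
    [\sum_g psi (\sum_(g a = 0) f a) t^(deg g)] over monic [g] is a polynomial of
    degree less than [d = deg f], and its logarithmic derivative involves the
    sums [S_n] over irreducible polynomials of degree dividing [n]. For even [n],
    a Stepanov auxiliary polynomial of degree less than
    [q^(n-1) + 3 d q^(n/2)] is divisible by every such irreducible polynomial on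
    which the trace of [f] has a given value; hence [S_n = O(q^(n/2))], which
    forces the inverse roots of the L-function to have modulus at most
    [sqrt q]. *)

Set Implicit Arguments. Unset Strict Implicit. Unset Printing Implicit Defensive.
Import Order.TTheory GRing.Theory Num.Theory.

(** * Hoelder moduli of continuity *)

Local Open Scope R_scope.

Lemma Rpow0_pos x q : 0 < x -> Rpow0 x q = Rpower x q.
Proof. by move=> x0; rewrite /Rpow0; case: RIneq.Req_EM_T => // ?; lra. Qed.

Lemma Rpow0_ge0 x q : 0 <= Rpow0 x q.
Proof. by rewrite /Rpow0; case: RIneq.Req_EM_T => ? /=; [lra | apply/Rlt_le/exp_pos]. Qed.

Lemma Rpower_gt0 x y : 0 < Rpower x y.
Proof. exact: exp_pos. Qed.

Lemma Rsum_le (I : finType) (u v : I -> R) : (forall i, u i <= v i) ->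
  \big[Rplus/0]_i u i <= \big[Rplus/0]_i v i.
Proof. by move=> uv; elim/big_ind2: _ => //; [lra | move=> *; lra]. Qed.

Lemma Rsum_gt0 (I : finType) (u : I -> R) j : (forall i, 0 <= u i) -> 0 < u j ->
  0 < \big[Rplus/0]_i u i.
Proof.
move=> u0 uj; rewrite (bigD1 j) //=; apply: Rplus_lt_le_0_compat => //.
by elim/big_ind: _ => //; [lra | move=> *; lra].
Qed.

Lemma Rsum_const s (c : R) : \big[Rplus/0]_(j < s) c = INR s * c.
Proof.
rewrite big_const_ord; elim: s => [|s IH]; first by rewrite /=; lra.
by rewrite S_INR iterS IH; lra.
Qed.

(** A vector with entries at most [t] has l^p norm at most s^(1/p) t, which is where s^(alpha/p)
    comes from. Positivity allows division by the norm in Hoelder quotients. *)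
Lemma lpnorm_bound p alpha s (d : 'I_s -> R) t : 0 < alpha -> pexp_ok p -> 0 < t ->
  (exists j, d j <> 0) -> (forall j, Rabs (d j) <= t) ->
  0 < Rpow0 (lpnorm p d) alpha <= s_pow p alpha s * Rpower t alpha.
Proof.
move=> a0 pok t0 [j dj] dt; have dj0 : 0 < Rabs (d j) by apply: Rabs_pos_lt.
case: p pok => [q|_] /=.
  move=> q1; set S := bigop.body _ _ _.
  have S0 : 0 < S.
    apply: (@Rsum_gt0 _ _ j) => [i|]; first exact: Rpow0_ge0.
    by rewrite Rpow0_pos //; apply: Rpower_gt0.
  have Sle : S <= INR s * Rpower t q.
    apply: (@Rle_trans _ (\big[Rplus/0]_(j < s) Rpower t q)).
      apply: Rsum_le => i; rewrite /Rpow0; case: RIneq.Req_EM_T => di /=; first exact/Rlt_le/Rpower_gt0.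
      apply: Rle_Rpower_l; first lra.
      by have := Rabs_pos (d i); have := dt i; lra.
    by rewrite Rsum_const; lra.
  have s0 : 0 < INR s by apply: lt_0_INR; apply/ssrnat.ltP; exact: leq_ltn_trans (ltn_ord j).
  rewrite (Rpow0_pos _ S0) Rpow0_pos; last exact: Rpower_gt0.
  split; first exact: Rpower_gt0.
  rewrite Rpower_mult.
  have -> : / q * alpha = alpha / q by field; lra.
  have aq : 0 < alpha / q by apply: Rdiv_lt_0_compat; lra.
  apply: Rle_trans; first exact: (Rle_Rpower_l _ _ _ (Rlt_le _ _ aq) (conj S0 Sle)).
  rewrite -Rpower_mult_distr //; last exact: Rpower_gt0.
  rewrite Rpower_mult; have -> : q * (alpha / q) = alpha by field; lra.
  lra.
set S := bigop.body _ _ _.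
have S1 : S <= t.
  apply: (big_ind (fun x => x <= t)); [lra | by move=> x y; apply: Rmax_lub | by []].
have S0 : 0 < S.
  apply: (Rlt_le_trans _ _ _ dj0); rewrite /S; move: (mem_index_enum j).
  elim: (index_enum _) => // i l IH; rewrite big_cons inE => /orP[/eqP ->|/IH h].
    exact: Rmax_l.
  by apply: Rle_trans h (Rmax_r _ _).
rewrite Rpow0_pos // Rmult_1_l; split; first exact: Rpower_gt0.
by apply: Rle_Rpower_l; [lra | split].
Qed.

Section UnitBall.
Variables (F : finFieldType) (N : nat) (psi : F -> Cplx) (phi mu : nat -> F).
Variables (alpha : R) (p : pexp) (s : nat) (h : ('I_s -> R) -> R).
Hypotheses (alpha_gt0 : 0 < alpha) (p_ok : pexp_ok p) (s_gt0 : (0 < s)%N).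
Hypothesis hW : in_W_unit_ball N psi phi mu alpha p h.

Let A := walsh_partial_sum N psi phi mu h N.

(** In the unit ball the Hoelder seminorm is at most 1 - [A], where [A] is the Walsh sum over k_j <
    N. Keeping the factor 1 - [A] later turns a sum of two errors into a maximum. *)
Definition holder_modulus (M : nat) : R := (1 - A) * s_pow p alpha s / Rpower (INR M) alpha.

Lemma s_pow_gt0 : 0 < s_pow p alpha s.
Proof. by case: (p) => [q|] /=; [apply: Rpower_gt0 | lra]. Qed.

(** The ball condition couples the Walsh sum to a Hoelder quotient, so one admissible pair is needed
    to isolate it: the points 0 and (1/2, ..., 1/2). *)
Lemma walsh_sum_le1 : 0 <= A <= 1.
Proof.
split.
  apply: (big_ind (fun x => 0 <= x)); [lra | move=> *; lra | move=> g _].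
  by rewrite /walsh_coef_abs; apply: sqrt_pos.
have c0 : in_unit_cube (fun _ : 'I_s => 0) by move=> j; lra.
have c1 : in_unit_cube (fun _ : 'I_s => 0 + / 2) by move=> j; lra.
have e : exists j : 'I_s, / 2 <> 0 by exists (Ordinal s_gt0); lra.
have := @hW N _ (fun=> / 2) c0 c1 e; rewrite -/A.
have [P0 _] : 0 < Rpow0 (lpnorm p (fun _ : 'I_s => / 2)) alpha <= s_pow p alpha s * Rpower (/ 2) alpha.
  by apply: lpnorm_bound => //; [lra | move=> j; rewrite Rabs_pos_eq; lra].
set D := Rabs _; have D0 : 0 <= D by apply: Rabs_pos.
have : 0 <= D / Rpow0 (lpnorm p (fun _ : 'I_s => / 2)) alpha.
  by apply: Rmult_le_pos => //; apply/Rlt_le/Rinv_0_lt_compat.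
lra.
Qed.

Lemma holder_modulusP M x y : (0 < M)%N -> in_unit_cube x -> in_unit_cube y ->
  (forall j, Rabs (x j - y j) <= / INR M) -> Rabs (h x - h y) <= holder_modulus M.
Proof.
move=> M0 xc yc xy; have MR : 0 < INR M by apply: lt_0_INR; apply/ssrnat.ltP.
have [_ A1] := walsh_sum_le1; have sp := s_pow_gt0.
have PM := Rpower_gt0 (INR M) alpha.
(* The ball condition only speaks of nonzero displacements. *)
have [E|ne] := Classical_Prop.classic (forall j, x j = y j).
  have -> : x = y by apply: functional_extensionality.
  rewrite Rminus_diag Rabs_R0 /holder_modulus.
  apply: Rmult_le_pos; last exact/Rlt_le/Rinv_0_lt_compat.
  by apply: Rmult_le_pos; lra.
have [j xyj] := Classical_Pred_Type.not_all_ex_not _ _ ne.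
pose d j := x j - y j.
have Ex : (fun j => y j + d j) = x by apply: functional_extensionality => i; rewrite /d; lra.
have dn : exists j, d j <> 0 by exists j; rewrite /d; lra.
have := @hW N y d yc; rewrite Ex -/A => /(_ xc dn) H.
have [P0 P1] := lpnorm_bound alpha_gt0 p_ok (Rinv_0_lt_compat _ MR) dn xy.
have {}H : Rabs (h x - h y) <= (1 - A) * Rpow0 (lpnorm p d) alpha.
  apply: (Rmult_le_reg_r (/ Rpow0 (lpnorm p d) alpha)); first exact: Rinv_0_lt_compat.
  by rewrite Rmult_assoc Rinv_r; lra.
apply: (Rle_trans _ _ _ H); rewrite /holder_modulus /Rdiv Rmult_assoc.
apply: Rmult_le_compat_l; first lra.
have -> : / Rpower (INR M) alpha = Rpower (/ INR M) alpha; last by [].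
by rewrite -Rpower_Ropp /Rpower ln_Rinv //; congr exp; lra.
Qed.

(** Gives the uniform continuity of [h] on which the convergence of its Riemann sums rests. *)
Lemma holder_modulus_cv e : 0 < e -> exists M, forall M', (M <= M')%N -> holder_modulus M' <= e.
Proof.
move=> e0; have [_ A1] := walsh_sum_le1; have sp := s_pow_gt0.
pose K := (1 - A) * s_pow p alpha s.
have K0 : 0 <= K by apply: Rmult_le_pos; lra.
(* [t] solves t^alpha = (K + 1) / e; the added 1 keeps the base positive when K = 0. *)
pose t := Rpower ((K + 1) / e) (/ alpha).
have t0 : 0 < t by apply: Rpower_gt0.
have [M [HM M0]] := archimed_cor1 (/ t) (Rinv_0_lt_compat _ t0).
have MR : 0 < INR M by apply: lt_0_INR.
have tM : t <= INR M.
  apply: Rlt_le; rewrite -(Rinv_inv t) -(Rinv_inv (INR M)).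
  by apply: Rinv_lt_contravar HM; apply: Rmult_lt_0_compat; apply: Rinv_0_lt_compat.
exists M => M' /ssrnat.leP/le_INR MM'.
rewrite /holder_modulus -/K.
have PM := Rpower_gt0 (INR M') alpha.
have Ke : 0 < (K + 1) / e by apply: Rdiv_lt_0_compat; lra.
apply: (Rmult_le_reg_r (Rpower (INR M') alpha)) => //.
have -> : K / Rpower (INR M') alpha * Rpower (INR M') alpha = K by field; lra.
have : (K + 1) / e <= Rpower (INR M') alpha.
  have -> : (K + 1) / e = Rpower t alpha.
    by rewrite /t Rpower_mult Rinv_l ?Rpower_1 //; lra.
  by apply: Rle_Rpower_l; lra.
move=> H; have : e * ((K + 1) / e) <= e * Rpower (INR M') alpha by apply: Rmult_le_compat_l; lra.
have -> : e * ((K + 1) / e) = K + 1 by field; lra.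
lra.
Qed.

End UnitBall.

From mathcomp Require Import ring lra zify complex.

Local Close Scope R_scope.
Local Open Scope ring_scope.

(** * Power sums of the roots of a polynomial *)
Section PowerSum.
Variable K : fieldType.
Implicit Types f g h : {poly K}.

(* [X g' / g = \sum_(g a = 0) X / (X - a)], so for [f] this extracts the sum of
   [f a] over the roots [a] of [g], without leaving the base field. *)
Definition power_sum f g : K := ((f * ('X * g^`())) %/ g)`_0.

(** X (gh)'/(gh) = X g'/g + X h'/h, and polynomial quotients are additive and unchanged by
    cancelling a common factor. *)
Lemma power_sumM f g h : g != 0 -> h != 0 ->
  power_sum f (g * h) = power_sum f g + power_sum f h.
Proof.
move=> g0 h0; rewrite /power_sum derivM.
rewrite (_ : f * _ = f * ('X * g^`()) * h + f * ('X * h^`()) * g); last by ring.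
by rewrite divpD coefD divp_pmul2r // [X in (_ + (X %/ _)`_0)]mulrC divp_pmul2l.
Qed.

Lemma power_sum1 f : power_sum f 1 = 0.
Proof. by rewrite /power_sum derivC !mulr0 div0p coef0. Qed.

(** With f - f(a) = u (X - a), the quotient of f X by X - a is f + a u, whose constant term is f(0)
    + a u(0) = f(a). *)
Lemma power_sum_XsubC f a : power_sum f ('X - a%:P) = f.[a].
Proof.
rewrite /power_sum derivXsubC mulr1.
have /factor_theorem [u Eu] : root (f - f.[a]%:P) a.
  by rewrite rootE !hornerE subrr.
have -> : f * 'X = (f + a *: u) * ('X - a%:P) + (a * f.[a])%:P.
  rewrite -mul_polyC mulrDl -mulrA -Eu polyCM.
  by ring.
rewrite divpD mulpK ?polyXsubC_eq0 // divp_small ?addr0; last first.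
  by rewrite size_XsubC (leq_ltn_trans (size_polyC_leq1 _)).
have := congr1 (horner^~ 0) Eu; rewrite !hornerE => E.
rewrite coefD coefZ -!horner_coef0 mulrC; apply/eqP; rewrite -subr_eq0 addrAC E.
by rewrite mulrN addNr.
Qed.

Lemma power_sum_prod_XsubC f (s : seq K) :
  power_sum f (\prod_(a <- s) ('X - a%:P)) = \sum_(a <- s) f.[a].
Proof.
elim: s => [|a s IH]; first by rewrite !big_nil power_sum1.
rewrite !big_cons power_sumM ?polyXsubC_eq0 //; last first.
  by rewrite monic_neq0 // monic_prod_XsubC.
by rewrite power_sum_XsubC IH.
Qed.

Lemma divp_coef0 g h : g \is monic -> (size h <= size g)%N ->
  (h %/ g)`_0 = h`_(size g).-1.
Proof.
move=> gm shg; have g0 : g != 0 by rewrite monic_neq0.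
pose c := h`_(size g).-1; pose r := h - c *: g.
have sg : (0 < size g)%N by rewrite size_poly_gt0.
have sr : (size r < size g)%N.
  rewrite -(prednK sg) ltnS; apply/leq_sizeP=> i; rewrite leq_eqVlt => /orP[/eqP<-|ig].
    by rewrite coefB coefZ -lead_coefE (monicP gm) mulr1 subrr.
  rewrite prednK // in ig.
  by rewrite coefB coefZ !nth_default ?mulr0 ?subrr // (leq_trans shg).
have -> : h = c *: g + r by rewrite addrC subrK.
rewrite divpD divpZl divpp // (divp_small sr) addr0 coefZ coef1 mulr1 coefD coefZ.
by rewrite -lead_coefE (monicP gm) mulr1 [r`_ _]nth_default ?addr0 // -ltnS prednK.
Qed.

(** A case of Newton's identities: the power sums of order below d do not see the coefficient of
    X^(k-d) of g, and the d-th one is affine in it with slope -d. *)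
Lemma power_sum_shift f g k d e : g \is monic -> size g = k.+1 ->
  size f = d.+1 -> (0 < d <= k)%N ->
  power_sum f (g + e *: 'X^(k - d)) = power_sum f g - d%:R * e * lead_coef f.
Proof.
move=> gm sg sf /andP[d0 dk]; set X' := 'X^(k - d).
have sX : (size (e *: X' : {poly K}) < size g)%N.
  rewrite (leq_ltn_trans (size_scale_leq _ _)) // size_polyXn sg ltnS ltn_subrL.
  by rewrite d0 (leq_trans d0).
set g2 := g + _.
have sg2 : size g2 = k.+1 by rewrite size_polyDl.
have g2m : g2 \is monic by rewrite monicE lead_coefDl // -monicE.
have g0 : g != 0 by rewrite monic_neq0.
have g20 : g2 != 0 by rewrite monic_neq0.
apply/eqP; rewrite addrC -subr_eq; apply/eqP.
(* Over the common denominator [g2 * g] the numerator has degree at most 2k, so [divp_coef0] reads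
   the constant term off its coefficient of degree 2k. *)
have -> : power_sum f g2 - power_sum f g
   = ((f * ('X * (g2^`() * g - g^`() * g2))) %/ (g2 * g))`_0.
  rewrite /power_sum -(divp_pmul2r (f * ('X * g2^`())) g0 g20).
  rewrite -(divp_pmul2r (f * ('X * g^`())) g20 g0) [g * g2]mulrC -coefB -divpN -divpD.
  by congr ((_ %/ _)`_0); ring.
have XX : 'X * X'^`() = X' *+ (k - d).
  rewrite /X' derivXn mulrnAr; case: (k - d)%N => [|n]; first by rewrite !mulr0n.
  by rewrite /= -exprS.
have -> : 'X * (g2^`() * g - g^`() * g2) = e *: (X' * (g *+ (k - d) - 'X * g^`())).
  rewrite /g2 derivD derivZ.
  transitivity (e%:P * (('X * X'^`()) * g - X' * ('X * g^`()))).
    by rewrite -!mul_polyC; ring.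
  by rewrite XX mul_polyC; congr (_ *: _); rewrite mulrBr mulrnAl mulrnAr.
set w := g *+ _ - _.
have cw i : w`_i = g`_i *+ (k - d) - g`_i *+ i.
  rewrite coefB coefMn coefXM coef_deriv; by case: i.
have sw : (size w <= k.+1)%N.
  by apply/leq_sizeP=> i ki; rewrite cw nth_default ?sg // !mul0rn subrr.
have wk : w`_k = - d%:R.
  have gk : g`_k = 1 by move/monicP: gm; rewrite lead_coefE sg.
  by rewrite cw gk natrB // addrAC subrr add0r.
have fd : f`_d = lead_coef f by rewrite lead_coefE sf.
have coef_top (u v : {poly K}) i j : (size u <= i.+1)%N -> (size v <= j.+1)%N ->
    (u * v)`_(i + j) = u`_i * v`_j.
  move=> su sv; rewrite coefM (bigD1 (inord i)) //= inordK ?ltnS ?leq_addr // addKn.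
  rewrite big1 ?addr0 // => l; rewrite -val_eqE /= inordK ?ltnS ?leq_addr // => li.
  have [lti|ltl] := ltnP l i.
    by rewrite [v`_ _]nth_default ?mulr0 // (leq_trans sv) //; lia.
  by rewrite [u`_ _]nth_default ?mul0r // (leq_trans su); lia.
have sfw : (size (f * w)%R <= (k + d).+1)%N.
  by rewrite (leq_trans (size_polyMleq _ _)) // sf addSn /= addnC -addSn leq_add2r.
have -> : f * (e *: (X' * w)) = e *: (X' * (f * w)).
  by rewrite -scalerAr mulrCA.
have sgg : size (g2 * g) = (k + k).+1 by rewrite size_mul // sg sg2 /= addnS.
rewrite divp_coef0 ?monicMl ?sgg //; last first.
  rewrite (leq_trans (size_scale_leq _ _)) // (leq_trans (size_polyMleq _ _)) //.
  by rewrite size_polyXn addSn /= (leq_trans (leq_add (leqnn _) sfw)) //; lia.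
rewrite coefZ coefXnM ltnNge (leq_trans (leq_subr _ _) (leq_addr _ _)) /=.
rewrite (_ : (k + k - (k - d) = d + k)%N); last by lia.
by rewrite coef_top ?sf // fd wk; ring.
Qed.

End PowerSum.

Lemma rmorph_power_sum (K L : fieldType) (u : {rmorphism K -> L}) (f g : {poly K}) :
  u (power_sum f g) = power_sum (map_poly u f) (map_poly u g).
Proof.
by rewrite /power_sum -coef_map map_divp !rmorphM /= map_polyX deriv_map.
Qed.

(** * Irreducible polynomials over a finite field *)
Section ResidueField.
Variable F : finFieldType.
Implicit Types f g P : {poly F}.
Local Notation q := #|F|.

Lemma expf_card_exp (x : F) r : x ^+ (q ^ r) = x.
Proof. by elim: r => [|r IH]; rewrite ?expr1 // expnS exprM expf_card. Qed.

Lemma pchar_card_nat (R : nzRingType) (u : {rmorphism F -> R}) r :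
  [pchar R]%R.-nat (q ^ r)%N.
Proof.
have [p p_pr pF] := finPcharP F.
rewrite pnatX; apply/orP; left.
have [n ->] : exists n, q = (p ^ n)%N.
  by exists (logn p q); exact: (card_pprimeChar pF).
rewrite pnatX; apply/orP; left; rewrite pnatE //.
exact: (rmorph_pchar u).
Qed.

(** The map x -> x^(q^r) is additive in characteristic p and fixes the coefficients, which come from
    F. *)
Lemma horner_frobenius (R : comNzRingType) (u : {rmorphism F -> R}) g x r :
  (map_poly u g).[x ^+ (q ^ r)] = (map_poly u g).[x] ^+ (q ^ r).
Proof.
have pn := pchar_card_nat u r.
elim/poly_ind: g => [|g c IH].
  by rewrite rmorph0 !horner0 expr0n expn_eq0 -leqn0 leqNgt (ltnW (finNzRing_gt1 F)).
rewrite rmorphD rmorphM /= map_polyX map_polyC /= !hornerE IH exprDn_pchar //.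
by rewrite exprMn -[in RHS]rmorphXn /= expf_card_exp.
Qed.

Lemma comp_polyXn_card g r : g \Po 'X^(q ^ r) = g ^+ (q ^ r).
Proof. by rewrite /comp_poly horner_frobenius -/(comp_poly 'X g) comp_polyXr. Qed.

Definition monic_irr P := (P \is monic) && irreducibleb P.

(** The field F[X]/(P), with [x] the class of X. Only these three properties are used, so
    congruences modulo P become evaluations at [x]. *)
Lemma residue_field P k : monic_irr P -> size P = k.+1 ->
  exists (K : finFieldType) (u : {rmorphism F -> K}) (x : K),
    [/\ #|K| = (q ^ k)%N,
        forall g, (P %| g) = ((map_poly u g).[x] == 0)
      & forall y, exists g, y = (map_poly u g).[x]].
Proof.
move=> /andP[Pm /irreducibleP Pirr] sP.
have hI : monic_irreducible_poly P by [].
pose K : finFieldType := {poly %/ P with hI}.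
pose u : {rmorphism F -> K} := qpolyC P.
have ev g : (map_poly u g).[in_qpoly P 'X : K] = in_qpoly P g.
  by have := in_qpoly_comp_horner P g 'X; rewrite comp_polyXr => ->.
exists K, u, (in_qpoly P 'X); split.
- by rewrite card_qfpoly sP.
- move=> g; rewrite ev -[in_qpoly P g == 0]val_eqE /= (mk_monicE hI).
  by rewrite /dvdp Pdiv.IdomainMonic.modpE.
- move=> y; exists (val y); rewrite ev.
  by apply: val_inj; rewrite /= Pdiv.CommonRing.rmodp_small // (size_mk_monic y).
Qed.

(** At an element x of the extension of degree n, this is the trace of f(x) down to F. *)
Definition trace_poly f n : {poly F} := \sum_(i < n) (f \Po 'X^(q ^ i)).

Lemma irr_dvd_Xq P k n : monic_irr P -> size P = k.+1 -> (k %| n)%N ->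
  P %| 'X^(q ^ n) - 'X.
Proof.
move=> Pi sP /dvdnP[j ->].
have [K [u [x [cK dK _]]]] := residue_field Pi sP.
rewrite dK rmorphB /= map_polyXn map_polyX !hornerE subr_eq0; apply/eqP.
elim: j => [|j IH]; first by rewrite mul0n expr1.
by rewrite mulSn expnD exprM -cK expf_card.
Qed.

(* Over the residue field, P splits as the product of X - x^(q^i), i < k. *)
Lemma irr_dvd_trace_poly f P k n : monic_irr P -> size P = k.+1 -> (k %| n)%N ->
  P %| trace_poly f n - (power_sum f P *+ (n %/ k))%:P.
Proof.
move=> Pi sP kn.
have [K [u [x [cK dK sK]]]] := residue_field Pi sP.
have k0 : (0 < k)%N.
  by have /andP[_ /andP[]] := Pi; rewrite sP.
have xk : x ^+ (q ^ k) = x by rewrite -cK expf_card.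
have per i : x ^+ (q ^ (i %% k)) = x ^+ (q ^ i).
  rewrite {2}(divn_eq i k) expnD exprM; congr (_ ^+ _).
  elim: (i %/ k)%N => [|j IH]; first by rewrite mul0n expr1.
  by rewrite mulSn expnD exprM xk.
(* A power of Frobenius fixing [x] fixes all of K, since K consists of polynomial values at [x];
   counting roots of X^(q^i) - X gives k <= i. Hence the first k conjugates are distinct. *)
have inj i : (0 < i)%N -> x ^+ (q ^ i) = x -> (k <= i)%N.
  move=> i0 xi; rewrite -(leq_exp2l _ _ (finNzRing_gt1 F)) -cK.
  have sX : size ('X^(q ^ i) - 'X : {poly K}) = (q ^ i).+1.
    rewrite size_polyDl size_polyXn // size_polyN size_polyX ltnS.
    by rewrite (leq_trans _ (ltn_expl i (finNzRing_gt1 F))).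
  rewrite -ltnS -sX cardE; apply: max_poly_roots; last exact: enum_uniq.
    by rewrite -size_poly_eq0 sX.
  apply/allP=> y _; have [g ->] := sK y.
  by rewrite rootE !hornerE -horner_frobenius xi subrr.
pose s := [seq x ^+ (q ^ i) | i <- iota 0 k].
have us : uniq s.
  apply/(uniqP 0) => i j; rewrite !inE size_map size_iota => ik jk.
  rewrite !(nth_map 0%N) ?size_iota // !nth_iota // !add0n.
  wlog ij : i j ik jk / (i <= j)%N.
    by move=> W E; case/orP: (leq_total i j) => /W h; [|apply/esym]; apply: h.
  move=> E; apply/eqP; rewrite eqn_leq ij /= leqNgt; apply/negP=> ltij.
  have /inj : x ^+ (q ^ (i + (k - j))) = x.
    by rewrite expnD exprM E -exprM -expnD subnKC // ltnW.
  by move: ltij jk; lia.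
have EP : map_poly u P = \prod_(y <- s) ('X - y%:P).
  have := @all_roots_prod_XsubC _ (map_poly u P) s.
  rewrite size_map_poly sP size_map size_iota lead_coef_map (monicP _) ?rmorph1 ?scale1r; last by case/andP: Pi.
  apply=> //; last by rewrite uniq_rootsE.
  apply/allP=> _ /mapP[i _ ->]; rewrite rootE horner_frobenius.
  by have := dvdpp P; rewrite dK => /eqP ->; rewrite expr0n expn_eq0 -leqn0 leqNgt (ltnW (finNzRing_gt1 F)).
have Eu : u (power_sum f P) = \sum_(i < k) (map_poly u f).[x ^+ (q ^ i)].
  by rewrite rmorph_power_sum EP power_sum_prod_XsubC big_map -(big_mkord xpredT (fun i => (map_poly u f).[x ^+ (q ^ i)])) /index_iota subn0.
rewrite dK rmorphB /= map_polyC /= hornerD hornerN hornerC raddfMn /= Eu subr_eq0.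
have -> : (map_poly u (trace_poly f n)).[x] = \sum_(i < n) (map_poly u f).[x ^+ (q ^ i)].
  rewrite rmorph_sum horner_sum; apply: eq_bigr => i _.
  by rewrite /= map_comp_poly map_polyXn horner_comp hornerXn.
(* The n conjugates run n / k times through the k distinct ones. *)
case/dvdnP: kn => j ->; rewrite mulnK //; apply/eqP.
elim: j => [|j IH]; first by rewrite mul0n big_ord0 mulr0n.
rewrite mulSn mulrS -IH big_split_ord /=; congr (_ + _).
by apply: eq_bigr => i _; rewrite -per modnDl per.
Qed.
End ResidueField.

(** * Monic polynomials and their irreducible factors *)

Section MonicPolynomials.
Variable F : finFieldType.
Implicit Types f g h P : {poly F}.

Definition polys n : seq {poly F} := [seq val g | g : {poly_n F}].

Lemma mem_polys n g : (g \in polys n) = (size g <= n)%N.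
Proof.
apply/mapP/idP => [[h _ ->]|sg]; first exact: size_npoly.
by exists (NPoly (sg : g \is a poly_of_size n)); rewrite ?mem_enum.
Qed.

Lemma polys_uniq n : uniq (polys n).
Proof. by rewrite map_inj_uniq ?enum_uniq //; apply: val_inj. Qed.

Definition monics n := [seq g <- polys n.+1 | (g \is monic) && (size g == n.+1)].

Lemma mem_monics n g : (g \in monics n) = (g \is monic) && (size g == n.+1).
Proof. by rewrite mem_filter mem_polys; case: eqP => [->|]; rewrite ?leqnn ?andbT ?andbF. Qed.

Lemma monics_uniq n : uniq (monics n).
Proof. by rewrite filter_uniq // polys_uniq. Qed.

Lemma monics0 : monics 0 = [:: 1].
Proof.
apply: perm_small_eq => //; apply: uniq_perm => //; first exact: monics_uniq.
move=> g; rewrite mem_monics inE; apply/andP/eqP => [[gm /eqP sg]|->].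
  have /eqP/size_poly1P[c c0 Eg] := sg.
  by move: gm; rewrite Eg monicE lead_coefC => /eqP ->.
by rewrite monic1 size_poly1.
Qed.

(** Degrees up to [n] and not just [n]: the list contains every irreducible factor of a polynomial
    of degree [n]. *)
Definition irrs n := [seq P <- polys n.+1 | monic_irr P].

Lemma mem_irrs n P : (P \in irrs n) = monic_irr P && (size P <= n.+1)%N.
Proof. by rewrite mem_filter mem_polys. Qed.

Lemma irrs_uniq n : uniq (irrs n).
Proof. by rewrite filter_uniq // polys_uniq. Qed.

Lemma monic_irr_monic P : monic_irr P -> P \is monic.
Proof. by case/andP. Qed.

Lemma monic_irr_size P : monic_irr P -> (0 < (size P).-1)%N.
Proof. by case/andP=> _ /andP[]; case: size => [|[]]. Qed.

Lemma monic_irr_factor g : g \is monic -> (1 < size g)%N ->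
  exists2 P, monic_irr P & P %| g.
Proof.
have [n] := ubnP (size g); elim: n g => // n IH g sn gm sg.
have [gi|gi] := boolP (irreducibleb g); first by exists g; rewrite ?dvdpp // /monic_irr gm.
have [h [hm sh hg hsg]] : exists h, [/\ h \is monic, (1 < size h)%N, h %| g & (size h < size g)%N].
  move: gi; rewrite /irreducibleb sg /= => /forallPn[h]; rewrite negb_imply -ltnNge => /andP[hg sh].
  have h0 : (val h) != 0 by apply: contraTneq sh => /= ->; rewrite size_poly0.
  have l0 : (lead_coef (val h))^-1 != 0 by rewrite invr_eq0 lead_coef_eq0.
  exists ((lead_coef (val h))^-1 *: (val h)); split.
  - by rewrite monicE lead_coefZ mulVf // lead_coef_eq0.
  - by rewrite size_scale.
  - by rewrite dvdpZl // dvdpE.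
  - by rewrite size_scale // (leq_ltn_trans (size_npoly h)) // ltn_predL ltnW.
have [P Pi Ph] := IH h (leq_trans hsg sn) hm sh.
by exists P => //; apply: dvdp_trans hg.
Qed.

(* The analogue for F[X] of log n = \sum_(d | n) Lambda(d). *)
Lemma degree_mangoldt M g : g \is monic -> (size g <= M.+1)%N ->
  (\sum_(P <- irrs M) \sum_(1 <= j < M.+1) (P ^+ j %| g)%R * (size P).-1)%N
    = (size g).-1.
Proof.
have [n] := ubnP (size g); elim: n g => // n IH g sn gm sM.
have [sg|sg] := leqP (size g) 1.
  have -> : g = 1.
    have s1 : size g == 1%N by rewrite eqn_leq sg size_poly_gt0 monic_neq0.
    have /size_poly1P[c c0 Eg] := s1.
    by move: gm; rewrite Eg monicE lead_coefC => /eqP ->.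
  rewrite size_poly1 big_seq big1 // => P; rewrite mem_irrs => /andP[Pi _].
  rewrite big_nat big1 // => j /andP[j1 _]; rewrite dvdp1.
  case: eqP => // E; have := size_exp P j; rewrite E /= => /esym/eqP.
  by rewrite muln_eq0 (gtn_eqF (monic_irr_size Pi)) (gtn_eqF j1).
(* Remove one factor [P0]: its multiplicity drops by one, and divisibility by powers of the other
   irreducible polynomials is unchanged. *)
have [P0 P0i P0g] := monic_irr_factor gm sg.
have [h Eg] : exists h : {poly F}, g = h * P0 by apply/dvdpP.
have P0m := monic_irr_monic P0i; have P00 := monic_neq0 P0m.
have hm : h \is monic by move: gm; rewrite Eg monicMr.
have h0 := monic_neq0 hm.
have sP := monic_irr_size P0i.
have sE : (size g).-1 = ((size P0).-1 + (size h).-1)%N.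
  rewrite Eg size_mul //.
  have -> : size h = (size h).-1.+1 by rewrite prednK // size_poly_gt0.
  have -> : size P0 = (size P0).-1.+1 by rewrite prednK // size_poly_gt0.
  by rewrite addSn addnS addnC.
have P0in : P0 \in irrs M.
  by rewrite mem_irrs P0i (leq_trans _ sM) // dvdp_leq ?monic_neq0 // Eg dvdp_mull.
rewrite sE -(IH h) //; first last.
- by move: sM sE sP; lia.
- by move: sn sE sP; lia.
rewrite !(bigD1_seq P0) ?irrs_uniq //= addnA; congr (_ + _)%N; last first.
  rewrite big_seq_cond [RHS]big_seq_cond; apply: eq_bigr => P /andP[].
  rewrite mem_irrs => /andP[Pi _] PP; apply: eq_bigr => j _.
  rewrite Eg mulrC Gauss_dvdpr //; apply: coprimep_expl.
  have /andP[_ /irreducibleP Pir] := Pi.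
  rewrite irreducible_poly_coprime //; apply: contra PP => PP0.
  have /andP[_ /irreducibleP P0ir] := P0i.
  rewrite -eqp_monic ?(monic_irr_monic Pi) //; apply: P0ir => //.
  by have := monic_irr_size Pi; case: (size P) => [|[]].
have ind j : (P0 ^+ j.+1 %| g) = (P0 ^+ j %| h) by rewrite Eg exprSr dvdp_mul2r.
case: M sM {IH P0in} => [|M sM]; first by case: (size g) sg => [|[]].
(* The sums for [g] and [h] are shifted by one in j. The term j = M + 1 for [h] vanishes because
   P0^(M+1) is too large to divide it. *)
rewrite [RHS]addnC big_add1 /= [X in (X + _)%N]big_nat_recr //= [X in (_ + X + _)%N](_ : _ = 0)%N; last first.
  apply/eqP; rewrite muln_eq0; apply/orP; left; rewrite eqb0; apply/negP=> Ph.
  have sPh : (size (P0 ^+ M.+1)%R <= size h)%N by apply: dvdp_leq.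
  have sPM : ((size (P0 ^+ M.+1)%R).-1 = (size P0).-1 * M.+1)%N by exact: size_exp.
  have := leq_pmull M.+1 sP; move: sM sE sP sPh; rewrite -sPM.
  by move: (size (P0 ^+ M.+1)%R) => a; lia.
rewrite addn0 addnC; under eq_bigr do rewrite ind.
by rewrite big_ltn // expr0 dvd1p mul1n.
Qed.

End MonicPolynomials.

(** * The L-function *)
Section LFunction.
Variables (F : finFieldType) (R : comNzRingType) (lam : {poly F} -> R).
Hypothesis lam1 : lam 1 = 1.
Hypothesis lamM : {in monic &, {morph lam : g h / g * h}}.
Implicit Types g h P : {poly F}.

Definition Lcoef n : R := \sum_(g <- monics F n) lam g.

(** By the Euler product, the coefficient of t^k in t L'(t) / L(t), where L(t) = \sum_n [Lcoef n]
    t^n: each power P^j of degree k contributes deg P lam(P)^j. *)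
Definition Lsum k : R :=
  \sum_(P <- irrs F k | ((size P).-1 %| k)%N)
    lam P ^+ (k %/ (size P).-1) *+ (size P).-1.

Lemma Lcoef0 : Lcoef 0 = 1.
Proof. by rewrite /Lcoef monics0 big_seq1. Qed.

Lemma lamX P j : P \is monic -> lam (P ^+ j) = lam P ^+ j.
Proof.
move=> Pm; elim: j => [|j IH]; first by rewrite !expr0.
by rewrite !exprS lamM ?IH // monic_exp.
Qed.

Lemma sum_monics_dvd n P e j : P \is monic -> size P = e.+1 ->
  \sum_(g <- monics F n | P ^+ j %| g) lam g =
  if (j * e <= n)%N then lam P ^+ j * Lcoef (n - j * e) else 0.
Proof.
move=> Pm sP; have Pjm : P ^+ j \is monic by rewrite monic_exp.
have Pj0 := monic_neq0 Pjm.
have sPj : size (P ^+ j) = (j * e).+1.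
  rewrite -[LHS]prednK ?size_poly_gt0 //.
  have -> : (size (P ^+ j)).-1 = ((size P).-1 * j)%N := size_exp P j.
  by rewrite sP mulnC.
case: leqP => jen; last first.
  rewrite big_seq_cond big1 // => g; rewrite mem_monics => /andP[/andP[gm /eqP sg] Pg].
  have : (size (P ^+ j)%R <= size g)%N by apply: dvdp_leq => //; exact: monic_neq0.
  by rewrite sPj sg ltnS leqNgt jen.
rewrite -big_filter -lamX // /Lcoef big_distrr /=.
transitivity (\sum_(g <- [seq P ^+ j * h | h <- monics F (n - j * e)]) lam g); last first.
  rewrite big_map big_seq [RHS]big_seq; apply: eq_bigr => h; rewrite mem_monics => /andP[hm _].
  by rewrite lamM.
apply: perm_big; apply: uniq_perm.
- by rewrite filter_uniq ?monics_uniq.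
- by rewrite map_inj_uniq ?monics_uniq // => x y /(mulfI Pj0).
move=> g; rewrite mem_filter mem_monics; apply/idP/mapP => [/and3P[Pg gm /eqP sg]|[h]].
  have [h Eg] : exists h : {poly F}, g = h * P ^+ j by apply/dvdpP.
  have hm : h \is monic by move: gm; rewrite Eg monicMr.
  exists h; last by rewrite mulrC.
  rewrite mem_monics hm /=; move: sg; rewrite Eg size_mul ?monic_neq0 // sPj addnS /=.
  by move=> E; rewrite -(eqn_add2r (j * e)) E addSn subnK.
rewrite mem_monics => /andP[hm /eqP sh] ->; rewrite dvdp_mulr ?dvdpp // monicMl //.
by rewrite hm size_mul ?monic_neq0 // sPj sh addnS /= addSn subnKC.
Qed.

(** The identity t L' = (t L'/L) L by coefficients: the weight n = deg g is expanded by
    [degree_mangoldt], and the sum over g is taken first. *)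
Lemma Lcoef_recursion n :
  Lcoef n *+ n = \sum_(1 <= k < n.+1) Lsum k * Lcoef (n - k).
Proof.
transitivity (\sum_(P <- irrs F n) \sum_(1 <= j < n.+1)
    (\sum_(g <- monics F n | P ^+ j %| g) lam g) *+ (size P).-1).
  rewrite /Lcoef -sumrMnl big_seq.
  transitivity (\sum_(g <- monics F n) \sum_(P <- irrs F n) \sum_(1 <= j < n.+1)
      (if P ^+ j %| g then lam g else 0) *+ (size P).-1).
    rewrite [RHS]big_seq; apply: eq_bigr => g; rewrite mem_monics => /andP[gm /eqP sg].
    have := @degree_mangoldt F n g gm; rewrite sg => /(_ (leqnn _)) /= {1}<-.
    rewrite -sumrMnr; apply: eq_bigr => P _; rewrite -sumrMnr; apply: eq_bigr => j _.
    by case: ifP; rewrite ?mul1n // mul0n mulr0n mul0rn.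
  rewrite exchange_big /=; apply: eq_bigr => P _.
  rewrite exchange_big /=; apply: eq_bigr => j _.
  by rewrite sumrMnl -big_mkcond.
transitivity (\sum_(P <- irrs F n) \sum_(1 <= k < n.+1 | ((size P).-1 %| k)%N)
   (lam P ^+ (k %/ (size P).-1) *+ (size P).-1) * Lcoef (n - k)).
  rewrite big_seq [RHS]big_seq; apply: eq_bigr => P; rewrite mem_irrs => /andP[Pi _].
  have Pm := monic_irr_monic Pi; have e0 := monic_irr_size Pi.
  set e := (size P).-1 in e0 *.
  have sP : size P = e.+1 by rewrite prednK // size_poly_gt0 monic_neq0.
  under eq_bigr do rewrite (sum_monics_dvd _ _ Pm sP).
  transitivity (\sum_(k <- [seq (j * e)%N | j <- iota 1 n & (j * e <= n)%N])
     (lam P ^+ (k %/ e) *+ e) * Lcoef (n - k)).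
    rewrite big_map big_filter /index_iota subn1 /= [RHS]big_mkcond; apply: eq_bigr => j _.
    by case: ifP; rewrite ?mul0rn // mulnK // mulrnAl.
  rewrite -[RHS]big_filter; apply: perm_big; apply: uniq_perm.
  - rewrite map_inj_uniq ?filter_uniq ?iota_uniq // => x y /eqP.
    by rewrite eqn_pmul2r // => /eqP.
  - by rewrite filter_uniq ?iota_uniq.
  move=> k; rewrite mem_filter mem_index_iota; apply/mapP/andP => [[j]|[/dvdnP[j ->] kn]].
    rewrite mem_filter mem_iota => /and3P[jn j0 _] ->; split; first exact: dvdn_mull.
    by rewrite muln_gt0 j0 e0.
  exists j => //; rewrite mem_filter mem_iota; move: kn; rewrite muln_gt0 e0 andbT ltnS => /andP[-> jn].
  by rewrite jn add1n ltnS (leq_trans _ jn) // leq_pmulr.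
under eq_bigr do rewrite big_mkcond.
rewrite exchange_big /= big_nat [RHS]big_nat; apply: eq_bigr => k /andP[k0 kn].
rewrite -big_mkcond /= -big_distrl /=; congr (_ * _).
(* A degree dividing k is at most k, so the lists for n and for k give the same sum. *)
rewrite -big_filter -[RHS]big_filter; apply: perm_big; apply: uniq_perm;
  rewrite ?filter_uniq ?polys_uniq // => P.
rewrite !mem_filter !mem_polys; have [dk|//] := boolP ((size P).-1 %| k)%N.
rewrite /=; case: (boolP (monic_irr P)) => //= Pi.
have dlek := dvdn_leq k0 dk; have := monic_irr_size Pi.
by move: dlek kn; case: (size P) => //= e ek kn e0; rewrite !ltnS ek (leq_trans ek).
Qed.

End LFunction.

(** * Stepanov's method *)
Lemma size_exp_neq0 (K : fieldType) (p : {poly K}) n : p != 0 ->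
  size (p ^+ n) = ((size p).-1 * n).+1.
Proof. by move=> p0; rewrite -size_exp prednK // size_poly_gt0 expf_neq0. Qed.

Section LinearDependence.
Variables (K : fieldType) (T : finType) (w : T -> {poly K}).

Lemma poly_lin_dep M : (forall t, size (w t) <= M)%N -> (M < #|T|)%N ->
  exists c : T -> K, (exists t, c t != 0) /\ \sum_t c t *: w t = 0.
Proof.
move=> sw MT; pose A : 'M[K]_(#|T|, M) := \matrix_(i, j) (w (enum_val i))`_j.
have /rowV0Pn[u /sub_kermxP uA u0] : kermx A != 0.
  rewrite kermx_eq0 /row_free; apply/negP=> /eqP E.
  by have := rank_leq_col A; rewrite E leqNgt MT.
exists (fun t => u 0 (enum_rank t)); split.
  have [i ui] : exists i, u 0 i != 0.
    apply/existsP; apply: contraNT u0 => /existsPn h; apply/eqP/rowP=> i; rewrite mxE.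
    by have := h i; rewrite negbK => /eqP.
  by exists (enum_val i); rewrite enum_valK.
apply/polyP=> j; rewrite coef_sum coef0; have [jM|Mj] := ltnP j M; last first.
  by rewrite big1 // => t _; rewrite coefZ nth_default ?mulr0 // (leq_trans (sw t)).
have /rowP/(_ (Ordinal jM)) := uA; rewrite !mxE => E; rewrite -[RHS]E.
rewrite (reindex (@enum_rank T)) /=; last by exists enum_val => x _; rewrite ?enum_rankK ?enum_valK.
by apply: eq_bigr => t _; rewrite coefZ mxE enum_rankK.
Qed.

Lemma lin_indep_size (c : T -> K) : injective (fun t => size (w t)) ->
  (forall t, w t != 0) -> (exists t, c t != 0) -> \sum_t c t *: w t != 0.
Proof.
move=> inj w0 [t0 ct0].
have [t ct tmax] := @arg_maxnP T t0 (fun t => c t != 0) (fun t => size (w t)) ct0.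
apply/eqP => /(congr1 (fun p : {poly K} => p`_(size (w t)).-1)).
rewrite coef_sum coef0 (bigD1 t) //= big1 ?addr0 => [|t' tt'].
  by move/eqP; rewrite coefZ -lead_coefE mulf_eq0 lead_coef_eq0 (negbTE ct) (negbTE (w0 t)).
rewrite coefZ; have [->|ct'] := eqVneq (c t') 0; first by rewrite mul0r.
have le : (size (w t') <= size (w t))%N := tmax t' ct'.
rewrite nth_default ?mulr0 //; move: le; rewrite leq_eqVlt => /orP[/eqP/inj E|].
  by rewrite E eqxx in tt'.
by case: (size (w t)).
Qed.

End LinearDependence.

Section Stepanov.
Variables (F : finFieldType) (f : {poly F}) (d : nat).
Local Notation q := #|F|.
Hypothesis sf : size f = d.+1.
Hypothesis d_gt0 : (0 < d)%N.
Hypothesis dq : coprime d q.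

Let q_gt1 : (1 < q)%N := finNzRing_gt1 F.

Lemma size_trace_poly r : size (trace_poly f r.+1) = (d * q ^ r).+1.
Proof.
have sfr i : size (f \Po 'X^(q ^ i)) = (d * q ^ i).+1.
  by rewrite comp_polyXn_card size_exp_neq0 ?sf // -size_poly_gt0 sf.
elim: r => [|r IH]; first by rewrite /trace_poly big_ord1 sfr.
rewrite /trace_poly big_ord_recr /= addrC size_polyDl ?sfr //.
by rewrite IH ltnS ltn_pmul2l // ltn_exp2l.
Qed.

(** For n = 2 (r + 1) this splits the trace into T and T(X^Q). *)
Lemma trace_polyD m n :
  trace_poly f (m + n) = trace_poly f m + (trace_poly f n \Po 'X^(q ^ m)).
Proof.
rewrite /trace_poly big_split_ord /=; congr (_ + _).
rewrite linear_sum /=; apply: eq_bigr => i _.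
by rewrite -comp_polyA comp_Xn_poly -exprM expnD mulnC.
Qed.

Variable r : nat.
Let n := (r.+1).*2.
Let Q := (q ^ r.+1)%N.
Let a := (q ^ r)%N.
(** There are I a q = aQ + 2dQ index triples, more than a low term has coefficients, while the high
    terms have degree below q^(n-1) + 3dQ; here q^(n-1) = aQ. *)
Let I := (a + d.*2)%N.
Let idx := ('I_I * 'I_a * 'I_q)%type.
Let T := trace_poly f r.+1.

(* If [x^(q^n) = x] and [T x + (T x)^Q = c], then the [Q]-th power of [highterm c t]
   at [x] is [lowterm t] at [x]: a linear relation between the low terms gives a
   combination of the high terms vanishing at all such [x]. *)
Let lowterm (t : idx) : {poly F} := 'X^(Q * t.1.2) * 'X^(t.1.1) * T ^+ t.2.
Let highterm c (t : idx) : {poly F} := 'X^(t.1.2) * 'X^(Q * t.1.1) * (c%:P - T) ^+ t.2.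

Let a_gt0 : (0 < a)%N.
Proof. by rewrite expn_gt0 ltnW. Qed.

Let Qa : Q = (q * a)%N.
Proof. by rewrite /Q expnS. Qed.

Let sT : size T = (d * a).+1.
Proof. exact: size_trace_poly. Qed.

Let sTc c : size (c%:P - T) = (d * a).+1.
Proof.
rewrite addrC size_polyDl size_polyN sT //.
by rewrite (leq_ltn_trans (size_polyC_leq1 _)) // ltnS muln_gt0 d_gt0.
Qed.

Let size_highterm c t : size (highterm c t) = (t.1.2 + Q * t.1.1 + d * a * t.2).+1.
Proof.
have T0 : c%:P - T != 0 by rewrite -size_poly_gt0 sTc.
rewrite /highterm -exprD mulrC size_mulXn ?expf_neq0 //.
by rewrite size_exp_neq0 // sTc addnS.
Qed.

Let size_lowterm t : (size (lowterm t) <= (Q * a.-1 + I.-1 + d * a * q.-1).+1)%N.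
Proof.
have T0 : T != 0 by rewrite -size_poly_gt0 sT.
rewrite /lowterm -exprD mulrC size_mulXn ?expf_neq0 // size_exp_neq0 // sT addnS ltnS.
have le_pred m (o : 'I_m) : (o <= m.-1)%N by rewrite -ltnS (ltn_predK (ltn_ord o)).
by rewrite !leq_add ?leq_mul.
Qed.

(** The degree is l + a (q i + d j): l is its residue modulo a, then j is determined modulo q
    because d is prime to q, and i follows. Distinct degrees make the high terms independent. *)
Let size_highterm_inj c : injective (fun t => size (highterm c t)).
Proof.
move=> [[i l] j] [[i' l'] j'] /=; rewrite !size_highterm /= Qa => -[E].
have E2 : ((q * i + d * j) * a + l = (q * i' + d * j') * a + l')%N.
  have re b x y z : ((b * x + d * y) * a + z = z + b * a * x + d * a * y)%N by lia.
  by rewrite !re.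
have El : l = l'.
  by apply: val_inj; have := congr1 (modn^~ a) E2; rewrite /= !modnMDl !modn_small.
have {E2} : (q * i + d * j = q * i' + d * j')%N.
  by move/eqP: E2; rewrite El eqn_add2r eqn_pmul2r // => /eqP.
have jj (x x' : nat) (y y' : 'I_q) : (q * x + d * y = q * x' + d * y')%N -> (y <= y')%N.
  move=> H; rewrite leqNgt; apply/negP=> lty.
  have : (q %| d * (y - y'))%N.
    have -> : (d * (y - y') = q * (x' - x))%N by rewrite !mulnBr; lia.
    exact: dvdn_mulr.
  rewrite Gauss_dvdr 1?coprime_sym // => /dvdn_leq; rewrite subn_gt0 => /(_ lty).
  by have := ltn_ord y; lia.
move=> H; have Ej : j = j' by apply: val_inj; apply/eqP; rewrite eqn_leq (jj _ _ _ _ H) (jj _ _ _ _ (esym H)).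
move: H; rewrite Ej El => /eqP; rewrite eqn_add2r eqn_pmul2l ?(ltnW q_gt1) // => /eqP Ei.
by congr (_, _, _); apply: val_inj.
Qed.

(** There are more low terms than coefficients, so they are dependent. The same combination of high
    terms is nonzero, of controlled degree, and divisible by every P with trace value c. *)
Lemma stepanov_polynomial c : exists B : {poly F},
  [/\ B != 0, (size B <= q ^ n.-1 + 3 * d * Q)%N &
      forall P, monic_irr P -> ((size P).-1 %| n)%N ->
        power_sum f P *+ (n %/ (size P).-1) = c -> P %| B].
Proof.
have [] := @poly_lin_dep F idx lowterm _ size_lowterm.
  rewrite !card_prod !card_ord Qa /I.
  move: a_gt0 q_gt1 d_gt0; case: (a) => // a' _; case: (#|F|) => // -[] // q' _.
  by case: (d) => // d' _; rewrite -!addnn /=; nia.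
move=> u [u0 Eu]; exists (\sum_t u t *: highterm c t); split.
- apply: lin_indep_size u0; first exact: size_highterm_inj.
  by move=> t; rewrite -size_poly_gt0 size_highterm.
- apply: (leq_trans (size_sum _ _ _)); apply/bigmax_leqP=> t _.
  rewrite (leq_trans (size_scale_leq _ _)) // size_highterm Qa.
  have -> : (q ^ n.-1 = q * a * a)%N by rewrite /n doubleS /= expnS -addnn expnD mulnA.
  have := ltn_ord t.1.1; have := ltn_ord t.1.2; have := ltn_ord t.2; rewrite {2}/I.
  move: (nat_of_ord t.1.1) (nat_of_ord t.1.2) (nat_of_ord t.2) => i l j jq la iI.
  have : (q * a * i.+1 <= q * a * (a + d.*2))%N by rewrite leq_mul2l iI orbT.
  have : (d * a * j.+1 <= d * a * q)%N by rewrite leq_mul2l jq orbT.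
  have : (1 * a <= q * a)%N by rewrite leq_mul2r ltnW ?orbT.
  by rewrite mulnDr !mulnS -muln2; lia.
move=> P Pi Pn Pc; have sP : size P = (size P).-1.+1.
  by rewrite prednK // size_poly_gt0 monic_neq0 // monic_irr_monic.
have P1 := irr_dvd_Xq Pi sP Pn; have P2 := irr_dvd_trace_poly f Pi sP Pn.
have [K [v [x [_ dK _]]]] := residue_field Pi sP.
move: P1 P2; rewrite Pc !dK {Pc}.
rewrite rmorphB /= map_polyXn map_polyX !hornerE subr_eq0 => /eqP xn.
rewrite rmorphB /= map_polyC /= !hornerE subr_eq0 => /eqP xT.
(* Frobenius moves the Q-th power onto the argument. At x^Q each high term becomes the low term at
   x, since x^(Q Q) = x and T(x^Q) = c - T(x). *)
suff : (map_poly v (\sum_t u t *: highterm c t)).[x] ^+ Q == 0 by rewrite expf_eq0 => /andP[].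
rewrite -horner_frobenius.
have <- : (map_poly v (\sum_t u t *: lowterm t)).[x] = 0 by rewrite Eu rmorph0 horner0.
apply/eqP; rewrite !rmorph_sum !horner_sum; apply: eq_bigr => t _ /=.
rewrite !map_polyZ !hornerZ; congr (_ * _).
have nE : (q ^ n = Q * Q)%N by rewrite /n -addnn expnD.
rewrite /highterm /lowterm !rmorphM !rmorphXn rmorphB /= !map_polyX map_polyC !hornerE -!exprM.
rewrite mulnA -nE (exprM _ (q ^ n)) xn; congr (_ * _ * _ ^+ _).
apply/eqP; rewrite subr_eq; apply/eqP; apply: (etrans (esym xT)).
rewrite /n -addnn trace_polyD rmorphD hornerD /= -/T map_comp_poly map_polyXn.
by rewrite horner_comp hornerXn.
Qed.

End Stepanov.

(** * Counting irreducible polynomials *)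

Section IrreducibleCounts.
Variable F : finFieldType.
Implicit Types g P B : {poly F}.
Local Notation q := #|F|.

Lemma size_monics n : size (monics F n) = (q ^ n)%N.
Proof.
rewrite -card_npoly cardE -(size_map (fun g : {poly_n F} => 'X^n + val g)).
apply: perm_size; apply: uniq_perm; first exact: monics_uniq.
  by rewrite map_inj_uniq ?enum_uniq // => x y /addrI /val_inj.
move=> g; rewrite mem_monics; apply/andP/mapP => [[gm /eqP sg]|[h _ ->]].
  have sgX : (g - 'X^n) \is a poly_of_size n.
    rewrite qualifE /=; apply/leq_sizeP=> j; rewrite leq_eqVlt coefB coefXn => /orP[/eqP <-|nj].
      by move: gm; rewrite monicE lead_coefE sg eqxx => /eqP ->; rewrite subrr.
    by rewrite gtn_eqF // subr0 nth_default // sg.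
  by exists (NPoly sgX); rewrite ?mem_enum //= addrC subrK.
have sh : (size (val h) < size ('X^n : {poly F}))%N by rewrite size_polyXn ltnS (size_npoly h).
by rewrite monicE lead_coefDl // lead_coefXn size_polyDl // size_polyXn.
Qed.

(** For lam = 1 there are q^n monic polynomials of degree n, so [Lcoef_recursion] reads n q^n =
    \sum_k S_k q^(n-k), which forces S_k = q^k by induction. *)
Lemma sum_irr_degrees k : (0 < k)%N ->
  (\sum_(P <- irrs F k | ((size P).-1 %| k)) (size P).-1 = q ^ k)%N.
Proof.
pose lam (g : {poly F}) : int := 1.
have EL n : Lcoef lam n = (q ^ n)%:Z.
  by rewrite /Lcoef big_const_seq count_predT size_monics iter_addr_0 natz.
have ES n : Lsum lam n = (\sum_(P <- irrs F n | ((size P).-1 %| n)) (size P).-1)%N%:Z.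
  rewrite -natz natr_sum; apply: eq_bigr => P _; by rewrite expr1n.
suff H n : (0 < n)%N -> Lsum lam n = (q ^ n)%:Z by move=> /H; rewrite ES => -[].
have [m] := ubnP n; elim: m n => // m IH n nm n0.
have := @Lcoef_recursion F _ lam erefl (fun _ _ _ _ => erefl) n.
rewrite big_nat_recr //= subnn EL Lcoef0 // mulr1.
rewrite (eq_big_nat _ _ (F2 := fun=> (q ^ n)%:Z)); last first.
  move=> j /andP[k0 kn]; rewrite IH // ?EL ?(leq_trans kn) // -PoszM -expnD subnKC //.
  exact: ltnW.
rewrite sumr_const_nat subn1.
have -> : (q ^ n)%:Z *+ n = (q ^ n)%:Z *+ n.-1 + (q ^ n)%:Z by rewrite -mulrSr prednK.
by move=> /addrI <-.
Qed.

(** This is [degree_mangoldt] for the monic multiple of [B], keeping only the terms j = 1 of the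
    polynomials in [s]. *)
Lemma sum_degrees_dvd (s : seq {poly F}) B : B != 0 -> uniq s ->
  (forall P, P \in s -> monic_irr P /\ P %| B) ->
  (\sum_(P <- s) (size P).-1 <= (size B).-1)%N.
Proof.
move=> B0 us sB; pose g := (lead_coef B)^-1 *: B.
have l0 : (lead_coef B)^-1 != 0 by rewrite invr_eq0 lead_coef_eq0.
have gm : g \is monic by rewrite monicE lead_coefZ mulVf // lead_coef_eq0.
have sg : size g = size B by rewrite size_scale.
have sB0 : (0 < size B)%N by rewrite size_poly_gt0.
rewrite -sg -(@degree_mangoldt F (size B).-1 g) ?sg ?prednK //.
have -> : (\sum_(P <- s) (size P).-1 = \sum_(P <- irrs F (size B).-1 | P \in s) (size P).-1)%N.
  rewrite -[RHS]big_filter; apply: perm_big; apply: uniq_perm; rewrite ?filter_uniq ?polys_uniq //.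
  move=> P; rewrite mem_filter mem_irrs prednK //; case Ps: (P \in s) => //=.
  by have [-> PB] := sB P Ps; rewrite dvdp_leq.
rewrite big_mkcond; apply: leq_sum => P _; case: ifP => // Ps.
have [Pi PB] := sB P Ps.
have B1 : (1 < size B)%N.
  rewrite (leq_trans _ (dvdp_leq B0 PB)) //.
  by have := monic_irr_size Pi; case: (size P) => [|[]].
by rewrite big_ltn ?prednK // expr1 dvdpZr // PB mul1n leq_addr.
Qed.

End IrreducibleCounts.

(** * The L-function of an additive character composed with f *)

Section CharacterSum.
Variables (F : finFieldType) (C : numClosedFieldType) (psi : F -> C).
Hypothesis psiD : forall x y, psi (x + y) = psi x * psi y.
Hypothesis psi0 : psi 0 = 1.
Hypothesis psi_nontriv : exists x, psi x != 1.
Variables (f : {poly F}) (d : nat).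
Local Notation q := #|F|.
Hypothesis sf : size f = d.+1.
Hypothesis d_gt0 : (0 < d)%N.
Hypothesis dq : coprime d q.

Definition char_lam (g : {poly F}) : C := psi (power_sum f g).
Local Notation lam := char_lam.

Lemma char_lam1 : lam 1 = 1.
Proof. by rewrite /lam power_sum1. Qed.

Lemma char_lamM : {in monic &, {morph lam : g h / g * h}}.
Proof. by move=> g h gm hm; rewrite /lam power_sumM ?monic_neq0 // psiD. Qed.

Lemma psiMn x n : psi (x *+ n) = psi x ^+ n.
Proof. by elim: n => [|n IH]; rewrite ?mulr0n ?psi0 // mulrS psiD IH exprS. Qed.

(** In characteristic p, psi(x)^p = psi(p x) = psi(0) = 1. *)
Lemma normr_psi x : `|psi x| = 1.
Proof.
have [p p_pr pF] := finPcharP F.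
apply/eqP; rewrite -(@pexpr_eq1 _ _ p) ?prime_gt0 // -normrX -psiMn.
by rewrite -mulr_natr (pcharf0 pF) mulr0 psi0 normr1.
Qed.

Lemma sum_psi : \sum_x psi x = 0.
Proof.
have [y y1] := psi_nontriv.
have E : \sum_x psi x = psi y * \sum_x psi x.
  rewrite big_distrr /= (reindex_inj (addrI y)); apply: eq_bigr => x _; exact: psiD.
apply/eqP; have /eqP : (1 - psi y) * \sum_x psi x = 0 by rewrite mulrBl mul1r -E subrr.
by rewrite mulf_eq0 subr_eq0 eq_sym (negbTE y1).
Qed.

Lemma natr_d_neq0 : d%:R != 0 :> F.
Proof.
have [p p_pr pF] := finPcharP F.
rewrite -(dvdn_pcharf pF) -prime_coprime // coprime_sym.
have Eq : q = (p ^ logn p q)%N := card_pprimeChar pF.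
move: dq (finNzRing_gt1 F); rewrite Eq; case: (logn p q) => // k.
by rewrite coprime_pexpr.
Qed.

(* Shifting the coefficient of [X^(n - d)] multiplies the sum by a nontrivial
   character value. *)
Lemma Lcoef_char_eq0 n : (d <= n)%N -> Lcoef lam n = 0.
Proof.
move=> dn; have [y y1] := psi_nontriv.
have f0 : lead_coef f != 0 by rewrite lead_coef_eq0 -size_poly_gt0 sf.
(* Chosen so that the shift by [e] changes the power sum of f by [y]. *)
pose e := - (y / (d%:R * lead_coef f)).
have ye : - (d%:R * e * lead_coef f) = y.
  by rewrite /e; field; rewrite natr_d_neq0 f0.
have E : Lcoef lam n = psi y * Lcoef lam n.
  rewrite /Lcoef big_distrr /=.
  transitivity (\sum_(g <- [seq g + e *: 'X^(n - d) | g <- monics F n]) lam g).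
    apply: perm_big; apply: uniq_perm; rewrite ?monics_uniq //.
      by rewrite map_inj_uniq ?monics_uniq // => x z /addIr.
    have mE u g : (g + u *: 'X^(n - d) \in monics F n) = (g \in monics F n).
      have mE1 u' g' : g' \in monics F n -> g' + u' *: 'X^(n - d) \in monics F n.
        rewrite !mem_monics => /andP[gm /eqP sg].
        have sX : (size (u' *: 'X^(n - d) : {poly F}) < size g')%N.
          rewrite (leq_ltn_trans (size_scale_leq _ _)) // size_polyXn sg ltnS ltn_subrL.
          by rewrite d_gt0 (leq_trans d_gt0).
        by rewrite monicE lead_coefDl // -monicE gm size_polyDl // sg eqxx.
      by apply/idP/idP => [/(mE1 (- u))|/mE1 //]; rewrite scaleNr addrK.
    move=> g; apply/idP/mapP => [gn|[h hn ->]]; last by rewrite mE.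
    exists (g + (- e) *: 'X^(n - d)); first by rewrite mE.
    by rewrite scaleNr subrK.
  rewrite big_map big_seq [RHS]big_seq; apply: eq_bigr => g; rewrite mem_monics => /andP[gm /eqP sg].
  by rewrite /lam (power_sum_shift _ gm sg sf) ?d_gt0 // ye psiD mulrC.
apply/eqP; have /eqP : (1 - psi y) * Lcoef lam n = 0 by rewrite mulrBl mul1r -E subrr.
by rewrite mulf_eq0 subr_eq0 eq_sym (negbTE y1).
Qed.

(** Stepanov's method bounds each count [N c] only from above. As the values of psi sum to 0, [N c]
    may be replaced, up to sign, by the nonnegative deficit A - [N c]; the deficits add up to q A -
    q^n = 3 d q q^(r+1). *)
Lemma Lsum_char_even r :
  `|Lsum lam (r.+1).*2| <= (3 * d * q)%:R * (q ^ r.+1)%:R.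
Proof.
set n := (r.+1).*2; pose v (P : {poly F}) := power_sum f P *+ (n %/ (size P).-1).
pose N c := (\sum_(P <- irrs F n | ((size P).-1 %| n) && (v P == c)) (size P).-1)%N.
pose A := (q ^ n.-1 + 3 * d * q ^ r.+1)%N.
have NA c : (N c <= A)%N.
  have [B [B0 sB PB]] := stepanov_polynomial sf d_gt0 dq r c.
  rewrite /N -big_filter (leq_trans _ (leq_trans (leq_pred _) sB)) // sum_degrees_dvd //.
    by rewrite filter_uniq ?irrs_uniq.
  move=> P; rewrite mem_filter mem_irrs => /andP[/andP[Pn /eqP vP] /andP[Pi _]].
  by split=> //; apply: PB.
have sN : (\sum_c N c = q ^ n)%N.
  rewrite -(@sum_irr_degrees F n) // (partition_big v xpredT) //.
have EL : Lsum lam n = - \sum_c psi c * (A - N c)%:R.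
  transitivity (\sum_c psi c * (N c)%:R).
    rewrite /Lsum (partition_big v xpredT) //=; apply: eq_bigr => c _.
    rewrite /N natr_sum big_distrr /=; apply: eq_bigr => P /andP[_ /eqP <-].
    by rewrite /v psiMn /lam mulr_natr.
  rewrite -sumrN; apply/eqP; rewrite -subr_eq0 -sumrB.
  rewrite (eq_bigr (fun c => psi c * A%:R)); last by move=> c _; rewrite natrB //; ring.
  by rewrite -big_distrl /= sum_psi mul0r.
rewrite EL normrN (le_trans (ler_norm_sum _ _ _)) //.
under eq_bigr do rewrite normrM normr_psi mul1r normr_nat.
rewrite -natr_sum -natrM ler_nat sumnB; last by move=> c _; exact: NA.
rewrite sN sum_nat_const /A -/q mulnDr -expnS prednK // addKn.
by rewrite mulnCA !mulnA.
Qed.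

End CharacterSum.

(** * Weil's bound *)
Section Amplification.
Variable C : numClosedFieldType.
Implicit Types (s t : seq C) (w x y K : C).

(** For L = \prod (1 - w X) with power sums p_k of the w, this is X L'/L = -\sum_k p_k X^k taken
    modulo X^(M+1), which avoids power series. *)
Lemma newton_prod s M : exists R : {poly C},
  'X * (\prod_(w <- s) (1 - w *: 'X))^`()
   + (\prod_(w <- s) (1 - w *: 'X)) * \sum_(1 <= k < M.+1) (\sum_(w <- s) w ^+ k) *: 'X^k
   = 'X^(M.+1) * R.
Proof.
elim: s => [|w s [R IH]].
  exists 0; rewrite big_nil derivC !mulr0 add0r mul1r big1 // => k _.
  by rewrite big_nil scale0r.
set L := \prod_(w <- s) _ in IH *; set S := \sum_(1 <= k < M.+1) _ in IH *.
have Tw : (1 - w *: 'X) * (\sum_(1 <= k < M.+1) w ^+ k *: 'X^k)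
    = w *: 'X - w ^+ M.+1 *: 'X^(M.+1) :> {poly C}.
  elim: M {S R IH} => [|M IH]; first by rewrite big_geq // mulr0 !expr1 subrr.
  rewrite big_nat_recr //= mulrDr IH mulrBl mul1r -scalerAr -scalerAl.
  by rewrite -exprS scalerA -exprSr addrA subrK.
exists ((1 - w *: 'X) * R - w ^+ M.+1 *: L).
rewrite big_cons -/L derivM derivB derivC derivZ derivX.
have -> : \sum_(1 <= k < M.+1) (\sum_(v <- w :: s) v ^+ k) *: 'X^k
    = (\sum_(1 <= k < M.+1) w ^+ k *: 'X^k) + S.
  by rewrite -big_split /=; apply: eq_bigr => k _; rewrite big_cons scalerDl.
transitivity ((1 - w *: 'X) * ('X * L^`() + L * S) - w *: 'X * L
   + L * ((1 - w *: 'X) * (\sum_(1 <= k < M.+1) w ^+ k *: 'X^k))).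
  by rewrite -!mul_polyC; ring.
by rewrite Tw IH -!mul_polyC; ring.
Qed.

Lemma newton_coef s n (L := \prod_(w <- s) (1 - w *: 'X)) :
  L`_n *+ n = - \sum_(1 <= k < n.+1) (\sum_(w <- s) w ^+ k) * L`_(n - k).
Proof.
have [R /(congr1 (fun p : {poly C} => p`_n))] := newton_prod s n.
rewrite -/L coefD coefXnM ltnSn coefXM.
have -> : (if n == 0%N then 0 else (L^`())`_n.-1) = L`_n *+ n.
  by case: n {R} => [|n]; rewrite ?mulr0n //= coef_deriv.
move/eqP; rewrite addr_eq0 => /eqP ->; congr (- _).
rewrite big_distrr coef_sum big_nat [RHS]big_nat; apply: eq_bigr => k /andP[k0 kn].
by rewrite /= -scalerAr coefZ coefMXn ltnNge -ltnS kn.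
Qed.

(** The w are the inverses of the roots of L, which are nonzero because L(0) = 1. *)
Lemma factor_one_sub (L : {poly C}) : L`_0 = 1 ->
  exists2 s, size s = (size L).-1 & L = \prod_(w <- s) (1 - w *: 'X).
Proof.
move=> L0; have [t Et] := closed_field_poly_normal L.
have Ln0 : L != 0 by apply: contra_eq_neq L0 => ->; rewrite coef0 eq_sym oner_neq0.
have l0 : lead_coef L != 0 by rewrite lead_coef_eq0.
have t0 z : z \in t -> z != 0.
  move=> zt; apply: contra_eq_neq L0 => z0; rewrite -horner_coef0.
  have -> : L.[0] = 0 by apply/eqP; rewrite -/(root L 0) Et rootZ // root_prod_XsubC -z0.
  by rewrite eq_sym oner_neq0.
exists [seq z^-1 | z <- t].
  by rewrite size_map {1}Et size_scale // size_prod_XsubC.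
rewrite big_map.
have E : \prod_(z <- t) ('X - z%:P) = (\prod_(z <- t) (- z)) *: \prod_(z <- t) (1 - z^-1 *: 'X).
  rewrite -mul_polyC rmorph_prod /= -big_split /= big_seq [RHS]big_seq; apply: eq_bigr => z zt.
  by rewrite polyCN mulrBr mulr1 mulNr mul_polyC scalerA mulfV ?t0 // scale1r opprK addrC.
rewrite E scalerA in Et.
have := L0; rewrite -horner_coef0 {1}Et hornerZ.
have -> : (\prod_(j <- t) (1 - j^-1 *: 'X)).[0] = 1.
  by rewrite horner_prod big1 // => z _; rewrite !hornerE ?mulr0 ?oppr0 ?subr0 ?addr0.
by rewrite mulr1 => cE; rewrite {1}Et cE scale1r.
Qed.

Hypothesis archi : forall x : C, 0 <= x -> exists n, x < n%:R.

(** Otherwise, for y > 0, Bernoulli's inequality and the archimedean property make (x/y)^r exceed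
    [K]. *)
Lemma geometric_growth x y K : 0 <= x -> 0 <= y -> 0 <= K ->
  (forall r, x ^+ r.+1 <= K * y ^+ r.+1) -> x <= y.
Proof.
move=> x0 y0 K0 H.
have [//|yx] := real_leP (ger0_real x0) (ger0_real y0).
have [y00|yn0] := eqVneq y 0.
  have := H 0%N; rewrite y00 !expr1 mulr0 -y00 => /(lt_le_trans yx).
  by rewrite ltxx.
have yp : 0 < y by rewrite lt0r yn0.
pose u := x / y - 1; have up : 0 < u by rewrite subr_gt0 ltr_pdivlMr // mul1r.
have B r : 1 + r%:R * u <= (x / y) ^+ r.
  elim: r => [|r IH]; first by rewrite mul0r addr0 expr0.
  have xy0 : 0 <= x / y by rewrite divr_ge0.
  rewrite exprS (le_trans _ (ler_wpM2l xy0 IH)) //.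
  have -> : x / y = 1 + u by rewrite addrC subrK.
  rewrite -subr_ge0.
  have -> : (1 + u) * (1 + r%:R * u) - (1 + r.+1%:R * u) = r%:R * (u * u) by rewrite -natr1; ring.
  by rewrite mulr_ge0 ?ler0n // mulr_ge0 // ltW.
have [n] := archi (divr_ge0 K0 (ltW up)); rewrite ltr_pdivrMr // => Kn.
have : 1 + n.+1%:R * u <= K.
  rewrite (le_trans (B _)) // expr_div_n ler_pdivrMr ?exprn_gt0 //; exact: H.
rewrite real_leNgt ?ger0_real // ?addr_ge0 ?ler01 ?mulr_ge0 ?ler0n ?(ltW up) //.
case/negP; rewrite (lt_le_trans Kn) // -natr1 mulrDl mul1r addrCA lerDl.
by rewrite addr_ge0 ?ler01 ?ltW.
Qed.

(* Applying to the power sums a polynomial that vanishes at all the other squares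
   isolates the powers of a single one. *)
Lemma power_sums_growth s K rho : 0 <= rho -> 0 <= K ->
  (forall r, `|\sum_(w <- s) w ^+ (r.+1).*2| <= K * rho ^+ r.+1) ->
  forall w, w \in s -> `|w| ^+ 2 <= rho.
Proof.
move=> rho0 K0 H w ws; set v := w ^+ 2.
pose t := [seq z ^+ 2 | z <- s].
(* [G] vanishes at the square of each element of [s] except [v]; duplicates are removed first so
   that it does not vanish at [v]. *)
pose G := \prod_(z <- rem v (undup t)) ('X - z%:P).
have vt : v \in t by apply/mapP; exists w.
have G0 z : z \in t -> z != v -> G.[z] = 0.
  move=> zt zv; apply/eqP; rewrite -/(root G z) root_prod_XsubC.
  by rewrite mem_rem_uniq ?undup_uniq // inE zv mem_undup.
have Gv : G.[v] != 0.
  by rewrite -/(root G v) root_prod_XsubC mem_rem_uniq ?undup_uniq // inE eqxx.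
pose c := (count_mem v t)%:R * G.[v].
have cn0 : c != 0 by rewrite mulf_neq0 // pnatr_eq0 -lt0n -has_count has_pred1.
(* Weighting the sums at shifted exponents by the coefficients of [G] leaves only the terms with z^2
   = v. *)
have E r : \sum_(l < size G) G`_l * (\sum_(z <- s) z ^+ (r + l).+1.*2) = c * v ^+ r.+1.
  transitivity (\sum_(z <- t) z ^+ r.+1 * G.[z]).
    under eq_bigr do rewrite big_distrr /=.
    rewrite exchange_big /= /t big_map; apply: eq_bigr => z _.
    rewrite horner_coef big_distrr /=; apply: eq_bigr => l _.
    by rewrite [RHS]mulrCA -exprD -exprM mul2n addSn.
  rewrite (bigID (pred1 v)) /= [X in _ + X]big_seq_cond [X in _ + X]big1 ?addr0; last first.
    by move=> z /andP[zt zv]; rewrite G0 ?mulr0.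
  rewrite (eq_bigr (fun=> v ^+ r.+1 * G.[v])); last by move=> z /eqP ->.
  by rewrite big_const_seq iter_addr_0 -mulr_natl /c -mulrA; congr (_ * _); rewrite mulrC.
pose K' := (\sum_(l < size G) `|G`_l| * K * rho ^+ l) / `|c|.
have K'0 : 0 <= K'.
  by rewrite divr_ge0 // sumr_ge0 // => l _; rewrite !mulr_ge0 ?exprn_ge0.
rewrite -normrX -/v; apply: (geometric_growth _ _ K'0) => // r.
rewrite /K' mulrAC ler_pdivlMr ?normr_gt0 // mulrC -normrX -normrM -E.
rewrite (le_trans (ler_norm_sum _ _ _)) // big_distrl /=; apply: ler_sum => l _.
rewrite normrM -!mulrA ler_wpM2l // (le_trans (H _)) // ler_wpM2l //.
by rewrite -exprD addnS addnC.
Qed.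

End Amplification.

Section WeilBound.
Variables (F : finFieldType) (C : numClosedFieldType) (psi : F -> C).
Hypothesis archi : forall x : C, 0 <= x -> exists n, x < n%:R.
Hypothesis psiD : forall x y, psi (x + y) = psi x * psi y.
Hypothesis psi0 : psi 0 = 1.
Hypothesis psi_nontriv : exists x, psi x != 1.
Local Notation q := #|F|.

(** L(t) has at most d - 1 inverse roots w, each with |w| <= sqrt q, and the character sum is S_1 =
    -\sum w. *)
Theorem weil_bound (f : {poly F}) d : size f = d.+1 -> (0 < d)%N -> coprime d q ->
  `|\sum_x psi f.[x]| <= d.-1%:R * sqrtC q%:R.
Proof.
move=> sf d0 dq; pose lam := char_lam psi f.
have lam1 : lam 1 = 1 := char_lam1 psi0 f.
have lamM : {in monic &, {morph lam : g h / g * h}} := char_lamM psiD f.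
(* The coefficients of index at least d vanish, so this is the full L-function. *)
pose L := \poly_(i < d) Lcoef lam i.
have LE n : L`_n = Lcoef lam n.
  by rewrite coef_poly; case: ltnP => // dn; rewrite (Lcoef_char_eq0 psiD psi_nontriv sf d0 dq dn).
have [s ss Es] : exists2 s, size s = (size L).-1 & L = \prod_(w <- s) (1 - w *: 'X).
  by apply: factor_one_sub; rewrite LE Lcoef0.
(* [Lcoef_recursion] and Newton's identities are the same recursion up to sign; as the coefficient
   of index 0 is 1, it determines the sums. *)
have ES n : (0 < n)%N -> Lsum lam n = - \sum_(w <- s) w ^+ n.
  have [m] := ubnP n; elim: m n => // m IH n nm n0.
  have := newton_coef s n; cbv zeta; rewrite -Es LE Lcoef_recursion // -sumrN.
  rewrite !big_nat_recr //= subnn !LE Lcoef0 // !mulr1 => E.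
  apply: (addrI (\sum_(1 <= i < n) Lsum lam i * Lcoef lam (n - i))); rewrite E.
  congr (_ + _); apply: eq_big_nat => k /andP[k0 kn].
  by rewrite LE IH ?mulNr // (leq_trans kn).
(* The monic irreducible polynomials of degree 1 are the X - x, on which lam equals psi(f(x)). *)
have E1 : \sum_x psi f.[x] = - \sum_(w <- s) w.
  rewrite -[in RHS](eq_bigr _ (fun w _ => expr1 w)) -ES // /Lsum.
  transitivity (\sum_(P <- [seq 'X - x%:P | x : F]) lam P ^+ (1 %/ (size P).-1) *+ (size P).-1).
    rewrite big_map big_enum /=; apply: eq_bigr => x _.
    by rewrite size_XsubC divn1 expr1 mulr1n /lam /char_lam power_sum_XsubC.
  rewrite -[RHS]big_filter; apply: perm_big; apply: uniq_perm.
  - by rewrite map_inj_uniq ?enum_uniq // => x y /addrI/oppr_inj/polyC_inj.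
  - by rewrite filter_uniq ?irrs_uniq.
  move=> P; rewrite mem_filter mem_irrs dvdn1; apply/mapP/and3P => [[x _ ->]|[sP Pi _]].
    rewrite size_XsubC; split=> //; rewrite /monic_irr monicXsubC /=.
    apply/irreducibleP; split; first by rewrite size_XsubC.
    move=> g g1 gX; rewrite -(dvdp_size_eqp gX) size_XsubC eqn_leq.
    have X0 : 'X - x%:P != 0 by rewrite polyXsubC_eq0.
    have := dvdp_leq X0 gX; rewrite size_XsubC => -> /=.
    have : (0 < size g)%N by rewrite size_poly_gt0 (dvdpN0 gX X0).
    by move: g1; case: (size g) => [|[]].
  have {}sP : size P = 2%N by move: sP; case: (size P) => //= k /eqP ->.
  exists (- P`_0); rewrite ?mem_enum //; apply/polyP=> i.
  rewrite polyCN opprK coefD coefX coefC.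
  case: i => [|[|i]]; rewrite ?add0r ?addr0 //.
    by have /monicP := monic_irr_monic Pi; rewrite lead_coefE sP.
  by rewrite nth_default ?sP.
(* Bounds on S_n for even n suffice, since they control the squares of the w. *)
have ws w : w \in s -> `|w| <= sqrtC q%:R.
  move=> ws; rewrite -(@ler_pXn2r _ 2) ?nnegrE ?sqrtC_ge0 ?ler0n // sqrtCK.
  apply: (@power_sums_growth _ archi s (3 * d * q)%:R) ws; rewrite ?ler0n // => r.
  rewrite -normrN -ES // -natrX; exact: Lsum_char_even.
rewrite E1 normrN (le_trans (ler_norm_sum _ _ _)) //.
apply: (@le_trans _ _ (\sum_(w <- s) sqrtC q%:R)).
  by rewrite big_seq [leRHS]big_seq; apply: ler_sum.
rewrite big_const_seq count_predT iter_addr_0 -[_ *+ size s]mulr_natl.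
rewrite ler_wpM2r ?sqrtC_ge0 ?ler0n // ler_nat ss.
by have := size_poly d (Lcoef lam); rewrite -/L; case: (size L) => //= k; case: (d).
Qed.

End WeilBound.

(** * Riemann sums *)
Section RiemannSums.
Variable s : nat.
Implicit Types (f g : ('I_s -> R) -> R) (x : 'I_s -> R).

Definition cube x := forall j, 0 <= x j < 1.

Definition grid_point m (a : {ffun 'I_s -> 'I_m}) : 'I_s -> R :=
  fun j => (a j)%:R / m%:R.

Lemma grid_point_cube m (a : {ffun 'I_s -> 'I_m}) : cube (grid_point a).
Proof.
move=> j; have m0 : (0 < m)%N by case: m a => // a; have := ltn_ord (a j).
by rewrite divr_ge0 ?ler0n //= ltr_pdivrMr ?ltr0n // mul1r ltr_nat.
Qed.

Lemma riemann_sumE f n :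
  riemann_sum f n = (\sum_(a : {ffun 'I_s -> 'I_n.+1}) f (grid_point a)) / n.+1%:R ^+ s.
Proof.
rewrite /riemann_sum RdivE RpowE INRE; congr (_ / _); apply: eq_bigr => a _.
by congr f; apply: functional_extensionality => j; rewrite RdivE !INRE.
Qed.

Lemma eq_riemann_sum f g n : (forall x, cube x -> f x = g x) ->
  riemann_sum f n = riemann_sum g n.
Proof.
move=> fg; rewrite !riemann_sumE; congr (_ / _); apply: eq_bigr => a _.
by apply: fg; apply: grid_point_cube.
Qed.

Lemma riemann_sum_lincomb (I : finType) (c : I -> R) (f : I -> ('I_s -> R) -> R) n :
  riemann_sum (fun x => \sum_i c i * f i x) n = \sum_i c i * riemann_sum (f i) n.
Proof.
rewrite riemann_sumE exchange_big /= big_distrl /=; apply: eq_bigr => i _.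
by rewrite riemann_sumE mulrA big_distrr.
Qed.

Lemma riemann_sum_le f g n : (forall x, cube x -> `|f x| <= g x) ->
  `|riemann_sum f n| <= riemann_sum g n.
Proof.
move=> fg; rewrite !riemann_sumE normrM [X in _ * X]ger0_norm ?invr_ge0 ?exprn_ge0 ?ler0n //.
rewrite ler_wpM2r ?invr_ge0 ?exprn_ge0 ?ler0n // (le_trans (ler_norm_sum _ _ _)) //.
by apply: ler_sum => a _; apply: fg; apply: grid_point_cube.
Qed.

(** The integral is chosen by [epsilon]; uniqueness of limits identifies it once the Riemann sums
    converge. *)
Lemma integral_unique f l : Un_cv (riemann_sum f) l -> integral f = l.
Proof.
move=> fl; apply: (UL_sequence (riemann_sum f)) (fl).
exact: (epsilon_spec (inhabits (IZR 0)) _ (ex_intro _ l fl)).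
Qed.

Lemma Un_cv_ext (u v : nat -> R) l : u =1 v -> Un_cv u l -> Un_cv v l.
Proof. by move=> /functional_extensionality ->. Qed.

Lemma Un_cv_cst (c : R) : Un_cv (fun=> c) c.
Proof. by move=> e e0; exists 0%N => n _; rewrite Rdist_eq. Qed.

Lemma Un_cv_lincomb (I : finType) (c : I -> R) (u : I -> nat -> R) (l : I -> R) :
  (forall i, Un_cv (u i) (l i)) ->
  Un_cv (fun n => \sum_i c i * u i n) (\sum_i c i * l i).
Proof.
move=> ul; rewrite -[X in Un_cv _ X]big_enum.
apply: (@Un_cv_ext (fun n => \sum_(i <- enum I) c i * u i n)) => [n|].
  by rewrite big_enum.
elim: (enum I) => [|i t IH].
  by apply: (@Un_cv_ext (fun=> 0)) => [n|]; rewrite big_nil //; exact: Un_cv_cst.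
rewrite big_cons.
apply: (@Un_cv_ext (fun n => Rplus (Rmult (c i) (u i n)) (\sum_(i <- t) c i * u i n))) => [n|].
  by rewrite big_cons.
by apply: CV_plus => //; apply: CV_mult (ul i); apply: Un_cv_cst.
Qed.

Lemma Un_cv_prod (I : finType) (u : I -> nat -> R) (l : I -> R) :
  (forall i, Un_cv (u i) (l i)) ->
  Un_cv (fun n => \prod_i u i n) (\prod_i l i).
Proof.
move=> ul; rewrite -[X in Un_cv _ X]big_enum.
apply: (@Un_cv_ext (fun n => \prod_(i <- enum I) u i n)) => [n|].
  by rewrite big_enum.
elim: (enum I) => [|i t IH].
  by apply: (@Un_cv_ext (fun=> 1)) => [n|]; rewrite big_nil //; exact: Un_cv_cst.
rewrite big_cons.
apply: (@Un_cv_ext (fun n => Rmult (u i n) (\prod_(i <- t) u i n))) => [n|].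
  by rewrite big_cons.
by apply: CV_mult.
Qed.

Definition in_cell L (c : {ffun 'I_s -> 'I_L}) x : bool :=
  [forall j, (c j)%:R <= x j * L%:R < (c j).+1%:R].

Lemma count_grid L m a : (0 < L)%N -> (a <= L)%N ->
  exists2 k, (\sum_(i < m) (i * L < a * m) = k)%N & (a * m <= k * L < a * m + L)%N.
Proof.
(* [k] is a m / L rounded up. *)
move=> L0 aL; pose k := ((a * m + L.-1) %/ L)%N.
have kL : (a * m <= k * L < a * m + L)%N.
  by have := divn_eq (a * m + L.-1) L; have := ltn_pmod (a * m + L.-1) L0; rewrite -/k; lia.
exists k => //.
have km : (k <= m)%N.
  rewrite -ltnS -(ltn_pmul2r L0); case/andP: kL => _ kL; rewrite (leq_trans kL) //.
  by rewrite mulSn addnC leq_add2l mulnC leq_mul2l aL orbT.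
have kE i : (i * L < a * m)%N = (i < k)%N.
  case/andP: kL => k1 k2; apply/idP/idP => h.
    by rewrite -(ltn_pmul2r L0) (leq_trans h).
  by rewrite -(ltn_add2r L) -mulSnr (leq_ltn_trans _ k2) // leq_mul2r h orbT.
under eq_bigr do rewrite kE.
rewrite -(big_mkord xpredT (fun i => nat_of_bool (i < k)%N)) (big_cat_nat (n := k)) //=.
rewrite (eq_big_nat _ _ (F2 := fun=> 1%N)) => [|i /andP[_ ->]] //.
rewrite sum_nat_const_nat subn0 muln1 [X in (_ + X)%N](eq_big_nat _ _ (F2 := fun=> 0%N)).
  by rewrite big1 // addn0.
by move=> i /andP[ki _]; rewrite ltnNge ki.
Qed.

(** The count in a cell is a difference of two rounded numbers, so it differs from (n + 1) / L by at
    most 1. *)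
Lemma Un_cv_cell_1d L (a : 'I_L) :
  Un_cv (fun n => (\sum_(i < n.+1) (a%:R <= (i%:R / n.+1%:R : R) * L%:R < a.+1%:R)%R%:R) / n.+1%:R)
    (L%:R^-1 : R).
Proof.
have L0 : (0 < L)%N by case: L a => // -[].
have LR : 0 < L%:R :> R by rewrite ltr0n.
have bound n : `|(\sum_(i < n.+1) (a%:R <= (i%:R / n.+1%:R : R) * L%:R < a.+1%:R)%R%:R) / n.+1%:R
   - L%:R^-1| <= n.+1%:R^-1 :> R.
  have nR : 0 < n.+1%:R :> R by rewrite ltr0n.
  have [k kE /andP[k1 k2]] := count_grid n.+1 L0 (ltnW (ltn_ord a)).
  have [k' kE' /andP[k1' k2']] := count_grid n.+1 L0 (ltn_ord a).
  have -> : \sum_(i < n.+1) (a%:R <= (i%:R / n.+1%:R : R) * L%:R < a.+1%:R)%R%:R = k'%:R - k%:R :> R.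
    rewrite -kE -kE' !natr_sum -sumrB; apply: eq_bigr => i _.
    rewrite mulrAC ler_pdivlMr // ltr_pdivrMr // -!natrM ler_nat ltr_nat.
    case: (ltnP (i * L) (a * n.+1)) => h /=.
      by rewrite (leq_trans h) ?subrr // leq_mul2r leqnSn orbT.
    by rewrite subr0.
  have {k1} k1 : a%:R * n.+1%:R <= k%:R * L%:R :> R by rewrite -!natrM ler_nat.
  have {k1'} k1' : a.+1%:R * n.+1%:R <= k'%:R * L%:R :> R by rewrite -!natrM ler_nat.
  have {k2} k2 : k%:R * L%:R <= a%:R * n.+1%:R + L%:R :> R by rewrite -!natrM -natrD ler_nat ltnW.
  have {k2'} k2' : k'%:R * L%:R <= a.+1%:R * n.+1%:R + L%:R :> R by rewrite -!natrM -natrD ler_nat ltnW.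
  rewrite -[a.+1%:R]natr1 in k1' k2'.
  have re (x l m : R) : l != 0 -> m != 0 -> x / m - l^-1 = (x * l - m) / l / m.
    by move=> l0 m0; field; rewrite ?l0 ?m0.
  rewrite re ?lt0r_neq0 //.
  rewrite normrM [X in _ * X]ger0_norm ?invr_ge0 ?ler0n // -[leRHS]mul1r.
  rewrite ler_wpM2r ?invr_ge0 ?ler0n // normrM [X in _ * X]ger0_norm ?invr_ge0 ?ler0n //.
  by rewrite ler_pdivrMr // mul1r ler_norml; apply/andP; split; lra.
move=> e /RltP e0; have e1 : 0 <= e^-1 by rewrite invr_ge0 ltW.
exists (Num.bound e^-1) => n /ssrnat.leP Nn; apply/RltP; rewrite RdistE.
rewrite (le_lt_trans (bound n)) // invf_plt ?posrE ?ltr0n //.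
by rewrite (lt_le_trans (archi_boundP e1)) // ler_nat (leq_trans Nn).
Qed.

Definition cell_ind L (c : {ffun 'I_s -> 'I_L}) x : R := (in_cell c x)%:R.

Lemma cell_indE L (c : {ffun 'I_s -> 'I_L}) x :
  cell_ind c x = \prod_j ((c j)%:R <= x j * L%:R < (c j).+1%:R)%R%:R.
Proof.
rewrite /cell_ind; case: (boolP (in_cell c x)) => [/forallP h|].
  by rewrite big1 // => j _; rewrite h.
by rewrite negb_forall => /existsP[j /negbTE h]; rewrite (bigD1 j) //= h mul0r.
Qed.

Lemma Un_cv_cell L (c : {ffun 'I_s -> 'I_L}) :
  Un_cv (riemann_sum (cell_ind c)) (L%:R^-1 ^+ s).
Proof.
rewrite (_ : _ ^+ s = \prod_(j < s) L%:R^-1); last by rewrite prodr_const card_ord.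
apply: Un_cv_ext (Un_cv_prod (fun j => Un_cv_cell_1d (c j))) => n.
rewrite riemann_sumE big_split /= prodr_const card_ord exprVn; congr (_ / _).
by rewrite bigA_distr_bigA /=; apply: eq_bigr => a _; rewrite cell_indE.
Qed.

Lemma cell_exists L x : (0 < L)%N -> cube x ->
  exists c : {ffun 'I_s -> 'I_L}, forall c', in_cell c' x = (c' == c).
Proof.
move=> L0 xc; have LR : 0 < L%:R :> R by rewrite ltr0n.
have x0 j : 0 <= x j * L%:R by rewrite mulr_ge0 ?ler0n //; case/andP: (xc j).
have tr j := truncn_itv (x0 j).
have tl j : (Num.truncn (x j * L%:R) < L)%N.
  have /andP[t1 _] := tr j; rewrite -(ltr_nat R) (le_lt_trans t1) //.
  by rewrite gtr_pMl //; case/andP: (xc j).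
exists [ffun j => Ordinal (tl j)] => c'; apply/forallP/eqP => [h|-> j]; last by rewrite ffunE; apply: tr.
apply/ffunP=> j; apply: val_inj; rewrite ffunE /=; apply/eqP; rewrite eqn_leq.
have /andP[h1 h2] := h j; have /andP[t1 t2] := tr j.
apply/andP; split; rewrite -ltnS -(ltr_nat R).
  exact: le_lt_trans h1 t2.
exact: le_lt_trans t1 h2.
Qed.

Lemma sum_cell_ind L x (v : {ffun 'I_s -> 'I_L} -> R) c : (0 < L)%N -> cube x ->
  in_cell c x -> \sum_c' v c' * cell_ind c' x = v c.
Proof.
move=> L0 xc; have [c0 h] := cell_exists L0 xc; rewrite h => /eqP ->.
rewrite (bigD1 c0) //= big1 ?addr0 /cell_ind ?h ?eqxx ?mulr1 // => c' cc.
by rewrite h (negbTE cc) mulr0.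
Qed.

(** Uniform limits of step functions are integrable: their Riemann sums are Cauchy because those of
    cell indicators converge. *)
Lemma riemann_cauchy u :
  (forall e : R, 0 < e -> exists (L : nat) (v : {ffun 'I_s -> 'I_L} -> R),
     forall x, cube x -> `|u x - \sum_c v c * cell_ind c x| <= e) ->
  exists l, Un_cv (riemann_sum u) l.
Proof.
move=> H; suff [l] : { l | Un_cv (riemann_sum u) l } by exists l.
apply: R_complete => e /RltP e0.
have {}e0 : 0 < e := e0.
(* One quarter for each of the two approximations and each of the two distances to the limit. *)
have e4 : 0 < e / 4 by lra.
have [L [v Hv]] := H _ e4.
have near n : `|riemann_sum u n - \sum_c v c * riemann_sum (cell_ind c) n| <= e / 4.
  rewrite -riemann_sum_lincomb.
  have -> : riemann_sum u n - riemann_sum (fun x => \sum_c v c * cell_ind c x) n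
     = riemann_sum (fun x => u x - \sum_c v c * cell_ind c x) n.
    by rewrite !riemann_sumE -mulrBl -sumrB.
  rewrite (le_trans (riemann_sum_le n Hv)) // riemann_sumE sumr_const.
  rewrite card_ffun !card_ord -[_ *+ _]mulr_natr natrX mulfK // expf_neq0 //.
  by rewrite pnatr_eq0.
have /(_ (e / 4)) [|M HM] := Un_cv_lincomb v (fun c => Un_cv_cell c).
  exact/RltP.
exists M => n m /HM /RltP hn /HM /RltP hm; apply/RltP; move: hn hm (near n) (near m).
rewrite !RdistE.
set A := riemann_sum u n; set B := riemann_sum u m; set A' := \sum_c _.
set l := \sum_c _; set B' := \sum_c _ => h1 h2 h3 h4.
have -> : A - B = (A - A') + (A' - l) - (B' - l) - (B - B') by ring.
apply: le_lt_trans (ler_normB _ _) _; apply: (@le_lt_trans _ _ (`|A - A'| + `|A' - l| + `|B' - l| + `|B - B'|)); last by lra.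
by rewrite lerD2r (le_trans (ler_normB _ _)) // lerD2r ler_normD.
Qed.

Section Modulus.
Variables (h : ('I_s -> R) -> R) (omega : nat -> R).
Hypothesis omega_cv : forall e : R, 0 < e ->
  exists M, forall M', (M <= M')%N -> omega M' <= e.
Hypothesis h_mod : forall M x y, (0 < M)%N -> cube x -> cube y ->
  (forall j, `|x j - y j| <= M%:R^-1) -> `|h x - h y| <= omega M.

Lemma in_cell_close L (c : {ffun 'I_s -> 'I_L}) x j : (0 < L)%N -> in_cell c x ->
  `|x j - grid_point c j| <= L%:R^-1.
Proof.
move=> L0 /forallP /(_ j) /andP[h1 h2]; have LR : 0 < L%:R :> R by rewrite ltr0n.
rewrite /grid_point; have -> : x j - (c j)%:R / L%:R = (x j * L%:R - (c j)%:R) / L%:R.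
  by rewrite mulrBl mulfK // lt0r_neq0.
rewrite normrM [X in _ * X]ger0_norm ?invr_ge0 ?ler0n // -[leRHS]mul1r.
rewrite ler_wpM2r ?invr_ge0 ?ler0n // ger0_norm ?subr_ge0 //.
by rewrite -natr1 in h2; lra.
Qed.

Lemma grid_point_cell L (c : {ffun 'I_s -> 'I_L}) : in_cell c (grid_point c).
Proof.
apply/forallP=> j; have L0 : (0 < L)%N by case: L c => // c; have := ltn_ord (c j).
by rewrite /grid_point divfK ?pnatr_eq0 -?lt0n // lexx ltr_nat /=.
Qed.

(** The grid with N M cells per side refines the one with N, so a fine cell lies inside or outside
    [a] as its corner does. *)
Lemma refine_cell N M (a : {ffun 'I_s -> 'I_N}) (c : {ffun 'I_s -> 'I_(N * M)}) x :
  (0 < N)%N -> (0 < M)%N -> in_cell c x -> in_cell a x = in_cell a (grid_point c).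
Proof.
move=> N0 M0 cx.
have H y : in_cell c y -> in_cell a y = [forall j, (a j * M <= c j < (a j).+1 * M)%N].
  move=> /forallP cy; apply: eq_forallb => j; have /andP[c1 c2] := cy j.
  have MR : 0 < M%:R :> R by rewrite ltr0n.
  rewrite natrM mulrA in c1 c2.
  rewrite -(ler_pM2r MR) -[(y j * _ < _)](ltr_pM2r MR) -!natrM.
  congr (_ && _); apply/idP/idP => h1.
  - by rewrite -ltnS -(ltr_nat R) (le_lt_trans h1).
  - by rewrite (le_trans _ c1) // ler_nat.
  - by rewrite -(ltr_nat R) (le_lt_trans c1).
  - by rewrite (lt_le_trans c2) // ler_nat.
by rewrite !H // grid_point_cell.
Qed.

Lemma Un_cv_cell_mul N (a : {ffun 'I_s -> 'I_N}) : (0 < N)%N ->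
  exists l, Un_cv (riemann_sum (fun x => h x * cell_ind a x)) l.
Proof.
move=> N0; apply: riemann_cauchy => e e0.
have [M HM] := omega_cv e0; pose L := (N * M.+1)%N.
have L0 : (0 < L)%N by rewrite muln_gt0 N0.
exists L, (fun c => h (grid_point c) * cell_ind a (grid_point c)) => x xc.
have [c hc] := cell_exists L0 xc.
have cx : in_cell c x by rewrite hc.
rewrite (sum_cell_ind _ L0 xc cx) /cell_ind (refine_cell _ N0 _ cx) // -mulrBl normrM.
have hx : `|h x - h (grid_point c)| <= e.
  rewrite (le_trans (@h_mod L _ _ L0 xc _ _)) //; first exact: grid_point_cube.
    by move=> j; apply: in_cell_close.
  by apply: HM; rewrite (leq_trans (leqnSn M)) // leq_pmull.
by case: in_cell; rewrite ?normr1 ?mulr1 // normr0 mulr0 ltW.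
Qed.

(** [J a] is the integral of [h] over the cell [a]. The second part serves for Walsh functions with
    k_j < N, which are constant on cells. *)
Lemma cell_integrals N : (0 < N)%N -> exists J : {ffun 'I_s -> 'I_N} -> R,
  (forall a, `|J a - h (grid_point a) / N%:R ^+ s| <= omega N / N%:R ^+ s) /\
  forall (W : {ffun 'I_s -> 'I_N} -> R) (w : ('I_s -> R) -> R),
    (forall x a, cube x -> in_cell a x -> w x = W a) ->
    integral (fun x => h x * w x) = \sum_a W a * J a.
Proof.
move=> N0; pose J a := proj1_sig (constructive_indefinite_description _ (Un_cv_cell_mul a N0)).
have HJ a : Un_cv (riemann_sum (fun x => h x * cell_ind a x)) (J a).
  by rewrite /J; case: constructive_indefinite_description.
exists J; split=> [a|W w wW].
  have bnd n : `|riemann_sum (fun x => h x * cell_ind a x) n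
      - h (grid_point a) * riemann_sum (cell_ind a) n| <= omega N * riemann_sum (cell_ind a) n.
    have -> : riemann_sum (fun x => h x * cell_ind a x) n
        - h (grid_point a) * riemann_sum (cell_ind a) n
        = riemann_sum (fun x => (h x - h (grid_point a)) * cell_ind a x) n.
      rewrite !riemann_sumE mulrA big_distrr -mulrBl -sumrB; congr (_ / _).
      by apply: eq_bigr => b _; rewrite mulrBl.
    have -> : omega N * riemann_sum (cell_ind a) n = riemann_sum (fun x => omega N * cell_ind a x) n.
      by rewrite !riemann_sumE mulrA big_distrr.
    apply: riemann_sum_le => x xc; rewrite normrM /cell_ind.
    case: (boolP (in_cell a x)) => [ax|_]; last by rewrite normr0 !mulr0.
    rewrite normr1 !mulr1; apply: h_mod => //; first exact: grid_point_cube.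
    by move=> j; apply: in_cell_close.
  rewrite -!exprVn.
  have cva := CV_mult _ _ _ _ (Un_cv_cst (h (grid_point a))) (Un_cv_cell a).
  have cvo := CV_mult _ _ _ _ (Un_cv_cst (omega N)) (Un_cv_cell a).
  rewrite ler_norml; apply/andP; split.
    rewrite lerNl opprB lerBlDr; apply/RleP.
    apply: (Rle_cv_lim _ cva (CV_plus _ _ _ _ cvo (HJ a))) => n /=; apply/RleP.
    by have := bnd n; rewrite ler_norml !RmultE !RplusE => /andP[]; lra.
  rewrite lerBlDr; apply/RleP.
  apply: (Rle_cv_lim _ (HJ a) (CV_plus _ _ _ _ cvo cva)) => n /=; apply/RleP.
  by have := bnd n; rewrite ler_norml !RmultE !RplusE => /andP[]; lra.
apply: integral_unique.
apply: Un_cv_ext (Un_cv_lincomb W HJ) => n; rewrite -riemann_sum_lincomb.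
apply: eq_riemann_sum => x xc; have [c hc] := cell_exists N0 xc.
have cx : in_cell c x by rewrite hc.
rewrite (wW x c xc cx) -(sum_cell_ind W N0 xc cx) big_distrr.
by apply: eq_bigr => a _; rewrite /= mulrCA.
Qed.

End Modulus.

End RiemannSums.

(** * Walsh functions on the grid *)
Section Exponents.
Variable b : nat.
Hypothesis b_gt1 : (1 < b)%N.

(** One in b consecutive integers is skipped, so j / (b - 1), rounded down, multiples of b precede
    the entry of index j. *)
Lemma cexpE j : cexp b j = (j + j %/ b.-1).+1.
Proof.
have b1 : (0 < b.-1)%N by rewrite -ltnS prednK // ltnW.
set u := (j %/ b.-1)%N; pose v := (j %% b.-1)%N.
have jE : j = (u * b.-1 + v)%N := divn_eq j b.-1.
have vb : (v < b.-1)%N by rewrite ltn_mod.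
have jb : (j + u = u * b + v)%N by rewrite jE -[in RHS](prednK (ltnW b_gt1)) mulnS; lia.
(* For n = j + u this gives j non-multiples of b, so the next integer j + u + 1 sits at position j
   of the list. *)
have cnt n : (count (fun i => ~~ (b %| i)) (iota 1 n) + n %/ b = n)%N.
  elim: n => [|n IH]; first by rewrite div0n.
  rewrite (_ : iota 1 n.+1 = iota 1 n ++ [:: n.+1]); last by rewrite -{1}[n.+1]addn1 iotaD.
  rewrite count_cat /= addn0 divnS ?(ltnW b_gt1) //.
  by case: (b %| n.+1)%N => /=; lia.
have cb : (b %| (j + u).+1)%N = false.
  rewrite jb -addnS dvdn_addr ?dvdn_mull // gtnNdvd //; lia.
have le : (j + u < b * j.+1)%N.
  rewrite jb [(b * _)%N]mulnC; have : (u <= j)%N by rewrite /u leq_div.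
  move=> uj; apply: (@leq_trans (u * b + b)%N); first by lia.
  by rewrite mulSn addnC leq_add2l leq_mul2r uj orbT.
rewrite /cexp (_ : (b * j.+1 = (j + u) + (b * j.+1 - (j + u)))%N); last by lia.
rewrite iotaD filter_cat nth_cat size_filter.
have cj : count (fun i => ~~ (b %| i)%N) (iota 1 (j + u)) = j.
  have := cnt (j + u)%N; rewrite {2}jb divnMDl ?(ltnW b_gt1) // (divn_small (d := b)); lia.
rewrite cj ltnn subnn; case E: (b * j.+1 - (j + u))%N => [|w]; first by lia.
by rewrite /= add1n cb.
Qed.

Lemma cexp_ndvd j : ~~ (b %| cexp b j)%N.
Proof.
rewrite cexpE; have b1 : (0 < b.-1)%N by rewrite -ltnS prednK // ltnW.
set u := (j %/ b.-1)%N; pose v := (j %% b.-1)%N.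
have jE : j = (u * b.-1 + v)%N := divn_eq j b.-1.
have vb : (v < b.-1)%N by rewrite ltn_mod.
have -> : ((j + u).+1 = u * b + v.+1)%N by rewrite {1}jE -[in RHS](prednK (ltnW b_gt1)) mulnS; lia.
by rewrite dvdn_addr ?dvdn_mull // gtnNdvd //; lia.
Qed.

Lemma cexp_ltn i j : (i < j)%N -> (cexp b i < cexp b j)%N.
Proof. by move=> ij; rewrite !cexpE ltnS -addSn leq_add // leq_div2r // ltnW. Qed.

(** The source of the factor b / (b - 1) in the error bound. *)
Lemma cexp_le j : (b.-1 * (cexp b j).-1 <= b * j)%N.
Proof.
rewrite cexpE /= mulnDr mulnC.
have := leq_divM j b.-1; have : (j * b = j * b.-1 + j)%N.
  by rewrite -{1}(prednK (ltnW b_gt1)) mulnS addnC.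
by rewrite [(b * j)%N]mulnC [(b.-1 * (_ %/ _))%N]mulnC; lia.
Qed.

End Exponents.

(** * Walsh inversion and quadrature of step functions *)

Section WalshQuadrature.
Variables (F : finFieldType) (C : numClosedFieldType) (psi : F -> C).
Hypothesis psiD : forall x y, psi (x + y) = psi x * psi y.
Hypothesis psi0 : psi 0 = 1.
Hypothesis psi_nontriv : exists x, psi x != 1.
Variables (N s : nat) (phi mu : nat -> F).
Hypotheses (N_gt0 : (0 < N)%N) (cardF : #|F| = N).
Hypothesis phi_inj : forall n1 n2, (n1 < N)%N -> (n2 < N)%N -> phi n1 = phi n2 -> n1 = n2.
Hypothesis mu_inj : forall n1 n2, (n1 < N)%N -> (n2 < N)%N -> mu n1 = mu n2 -> n1 = n2.
Hypothesis mu0 : mu 0 = 0.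
Implicit Types (k a : {ffun 'I_s -> 'I_N}).

(** For k_j < N, wal_k is constant on the cell [a], with value psi of this element. *)
Definition digit_dot k a : F := \sum_j mu (k j) * phi (a j).

Lemma psi_sum (I : finType) (u : I -> F) : psi (\sum_i u i) = \prod_i psi (u i).
Proof. exact: (big_morph psi psiD psi0). Qed.

Lemma psiN x : psi (- x) = (psi x)^-1.
Proof.
have E : psi x * psi (- x) = 1 by rewrite -psiD subrr.
have x0 : psi x != 0 by apply: contra_eq_neq E => ->; rewrite mul0r eq_sym oner_neq0.
by apply: (mulfI x0); rewrite E mulfV.
Qed.

Lemma ord_bij (g : nat -> F) :
  (forall n1 n2, (n1 < N)%N -> (n2 < N)%N -> g n1 = g n2 -> n1 = n2) ->
  bijective (fun i : 'I_N => g i).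
Proof.
move=> gi; apply: inj_card_bij; last by rewrite card_ord cardF.
by move=> i j /gi E; apply: val_inj; apply: E.
Qed.

Lemma sum_psi_mu y : \sum_(i < N) psi (mu i * y) = if y == 0 then N%:R else 0.
Proof.
case: eqP => [->|/eqP y0].
  under eq_bigr do rewrite mulr0 psi0.
  by rewrite sumr_const card_ord.
rewrite -[RHS](sum_psi psiD psi_nontriv) [RHS](reindex_inj (mulIf y0)) /=.
by rewrite [RHS](reindex (fun i : 'I_N => mu i)) //; apply: onW_bij; apply: ord_bij.
Qed.

(** The sum factors over coordinates. In each, mu runs over F, so distinct digits give a full sum of
    a nontrivial character, which is 0. *)
Lemma walsh_orthogonality a a' :
  \sum_k psi (digit_dot k a) * psi (- digit_dot k a') = if a == a' then N%:R ^+ s else 0.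
Proof.
transitivity (\prod_(j < s) \sum_(i < N) psi (mu i * (phi (a j) - phi (a' j)))).
  rewrite bigA_distr_bigA /=; apply: eq_bigr => k _; rewrite -psiD -psi_sum; congr psi.
  by rewrite /digit_dot -sumrB; apply: eq_bigr => j _; rewrite mulrBr.
under eq_bigr do rewrite sum_psi_mu subr_eq0.
case: eqP => [->|/eqP ne].
  by under eq_bigr do rewrite eqxx; rewrite prodr_const card_ord.
have [j aj] : exists j, a j != a' j.
  by apply/existsP; apply: contraNT ne => /existsPn h; apply/eqP/ffunP=> j; apply/eqP; rewrite -[_ == _]negbK.
rewrite (bigD1 j) //=; case: eqP => [/phi_inj E|_]; last by rewrite mul0r.
by case/eqP: aj; apply: val_inj; apply: E.
Qed.

Variable J : {ffun 'I_s -> 'I_N} -> C.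

(** The Walsh coefficient of the step function with integral [J a] over each cell [a], psi(-x) being
    the conjugate of psi(x). *)
Definition dual_coef k : C := \sum_a J a * psi (- digit_dot k a).

Lemma walsh_inversion a : \sum_k dual_coef k * psi (digit_dot k a) = N%:R ^+ s * J a.
Proof.
under eq_bigr do rewrite /dual_coef big_distrl /=.
rewrite exchange_big /= (bigD1 a) //= [X in _ + X]big1 ?addr0 => [|a' aa].
  under eq_bigr do rewrite -mulrA [psi (- _) * _]mulrC.
  by rewrite -big_distrr /= walsh_orthogonality eqxx mulrC.
under eq_bigr do rewrite -mulrA [psi (- _) * _]mulrC.
by rewrite -big_distrr /= walsh_orthogonality eq_sym (negbTE aa) mulr0.
Qed.

(** By inversion, N^s J is a combination of Walsh functions. Frequency 0 is integrated exactly, and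
    every other one contributes at most [X] times the modulus of its coefficient. *)
Lemma walsh_quadrature (pts : 'I_N -> {ffun 'I_s -> 'I_N}) (X : C) : 0 <= X ->
  (forall k, (exists j, k j != 0 :> nat) -> `|\sum_n psi (digit_dot k (pts n))| <= N%:R * X) ->
  `|\sum_a J a - (\sum_n N%:R ^+ s * J (pts n)) / N%:R| <= X * \sum_k `|dual_coef k|.
Proof.
move=> X0 HX; pose k0 : {ffun 'I_s -> 'I_N} := [ffun=> Ordinal N_gt0].
have d0 a : digit_dot k0 a = 0.
  by rewrite /digit_dot big1 // => j _; rewrite ffunE /= mu0 mul0r.
have N0 : N%:R != 0 :> C by rewrite pnatr_eq0 -lt0n.
have NR : 0 < N%:R :> C by rewrite ltr0n.
have -> : \sum_a J a = dual_coef k0.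
  by apply: eq_bigr => a _; rewrite d0 oppr0 psi0 mulr1.
under eq_bigr do rewrite -walsh_inversion.
rewrite exchange_big /= (bigD1 k0) //=.
under eq_bigr do rewrite d0 psi0 mulr1.
rewrite sumr_const card_ord -[_ *+ _]mulr_natr mulrDl mulfK // opprD addrA subrr add0r normrN.
rewrite normrM normfV normr_nat ler_pdivrMr //.
apply: le_trans (ler_norm_sum _ _ _) _.
rewrite [leRHS](_ : _ = \sum_k N%:R * X * `|dual_coef k|); last by rewrite -big_distrr /=; ring.
rewrite [leRHS](bigD1 k0) //= -[leLHS]add0r lerD //.
  by rewrite !mulr_ge0 ?ler0n.
apply: ler_sum => k kk0; rewrite -big_distrr /= normrM mulrC ler_wpM2r //; apply: HX.
apply/existsP; apply: contraNT kk0 => /existsPn h; apply/eqP/ffunP=> j.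
by apply: val_inj; rewrite ffunE /=; apply/eqP; rewrite -[_ == _]negbK.
Qed.

End WalshQuadrature.

(** * Character sums over the point set, in [R[i]] *)

Local Open Scope complex_scope.
Definition toC (z : Cplx) : R[i] := z.1 +i* z.2.

Lemma toCM z w : toC (Cmul z w) = toC z * toC w.
Proof. by case: z => a b; case: w => c d. Qed.

Lemma complex_archi (x : R[i]) : 0 <= x -> exists n, x < n%:R.
Proof.
case: x => a b; rewrite lecE /= => /andP[/eqP -> a0].
exists (Num.bound a); rewrite -(rmorph_nat (real_complex R)) ltcR.
exact: archi_boundP.
Qed.

Lemma sqrtC_nat n : sqrtC (n%:R : R[i]) = (Num.sqrt n%:R)%:C.
Proof.
rewrite -[RHS]sqrCK ?ler0c ?sqrtr_ge0 // -rmorphXn /= sqr_sqrtr ?ler0n //.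
by rewrite rmorph_nat.
Qed.

Section Monomials.
Variables (F : finFieldType) (b m s : nat) (psi : F -> R[i]).
Hypotheses (b_prime : prime b) (cardF : #|F| = (b ^ m)%N).
Hypothesis psiD : forall x y, psi (x + y) = psi x * psi y.
Hypothesis psi0 : psi 0 = 1.
Hypothesis psi_nontriv : exists x, psi x != 1.

(** As the exponents increase, the degree is the exponent of the largest index with nonzero
    coefficient. It is prime to b, so [weil_bound] applies, and [cexp_le] bounds it. *)
Lemma monomial_sum_bound (c : 'I_s -> F) : (exists j, c j != 0) ->
  `|\sum_x psi (\sum_j c j * x ^+ cexp b j)| <=
  ((b%:R * (s%:R - 1) + 1) / (b%:R - 1) * Num.sqrt (b ^ m)%:R)%:C.
Proof.
have b1 := prime_gt1 b_prime.
move=> [j0 cj0]; have [J cJ Jmax] := @arg_maxnP _ j0 (fun j => c j != 0) val cj0.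
pose f : {poly F} := \sum_j c j *: 'X^(cexp b j).
have fE x : f.[x] = \sum_j c j * x ^+ cexp b j.
  by rewrite horner_sum; apply: eq_bigr => j _; rewrite hornerZ hornerXn.
have sf : size f = (cexp b J).+1.
  rewrite /f (bigD1 J) //= size_polyDl size_scale ?size_polyXn // ltnS.
  apply: (leq_trans (size_sum _ _ _)); apply/bigmax_leqP=> j jJ.
  have [->|cj] := eqVneq (c j) 0; first by rewrite scale0r size_poly0.
  rewrite (leq_trans (size_scale_leq _ _)) // size_polyXn cexp_ltn //.
  rewrite ltn_neqAle; apply/andP; split; first exact: jJ.
  exact: Jmax.
have d0 : (0 < cexp b J)%N by rewrite cexpE.
have dq : coprime (cexp b J) #|F|.
  by rewrite cardF coprimeXr // coprime_sym prime_coprime // cexp_ndvd.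
have := weil_bound complex_archi psiD psi0 psi_nontriv sf d0 dq.
under eq_bigr do rewrite fE.
move=> /le_trans -> //; rewrite cardF sqrtC_nat -(rmorph_nat (real_complex R)) -rmorphM lecR.
rewrite ler_wpM2r ?sqrtr_ge0 //.
have bR : 0 < b%:R - 1 :> R by rewrite subr_gt0 ltr1n.
rewrite ler_pdivlMr //.
have := cexp_le b1 J; rewrite -(ler_nat R) !natrM -subn1 natrB ?(ltnW b1) // => H.
have Js : J%:R <= s%:R - 1 :> R.
  by rewrite lerBrDr natr1 ler_nat.
have : b%:R * J%:R <= b%:R * (s%:R - 1) :> R by rewrite ler_wpM2l ?ler0n.
by move: H; rewrite mulrC; lra.
Qed.

End Monomials.

(** * The error on the unit ball *)

Section Main.
Variables (alpha : R) (p : pexp) (b m s : nat) (F : finFieldType).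
Variables (psi : F -> Cplx) (phi mu : nat -> F) (phiinv : F -> nat).
Local Notation N := (b ^ m)%N.
Hypotheses (alpha_gt0 : Rlt 0 alpha) (p_ok : pexp_ok p).
Hypotheses (b_prime : prime b) (cardF : #|F| = N).
Hypothesis s_gt0 : (1 <= s)%N.
Hypothesis psi_char : nontrivial_additive_char psi.
Hypothesis phiK : forall n, (n < N)%N -> phiinv (phi n) = n.
Hypothesis phiinvK : forall y : F, (phiinv y < N)%N /\ phi (phiinv y) = y.
Hypothesis mu_inj : forall n1 n2, (n1 < N)%N -> (n2 < N)%N -> mu n1 = mu n2 -> n1 = n2.
Hypothesis mu0 : mu 0%N = 0.
Variable h : ('I_s -> R) -> R.
Hypothesis hW : in_W_unit_ball N psi phi mu alpha p h.

Let psiC x := toC (psi x).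

Let psiCD x y : psiC (x + y) = psiC x * psiC y.
Proof. by case: psi_char => H _; rewrite /psiC H toCM. Qed.

Let psiC0 : psiC 0 = 1.
Proof.
case: psi_char => _ [H _]; have n0 : psiC 0 != 0.
  apply/eqP => E; case: (H 0); case: E; rewrite /Defs.C0; case: (psi 0) => x y /= -> ->; by [].
by apply: (mulfI n0); rewrite mulr1 -psiCD addr0.
Qed.

Let psiC_nontriv : exists x, psiC x != 1.
Proof.
case: psi_char => _ [_ [x H]]; exists x; apply/eqP => E; case: H; case: E.
by rewrite /Defs.C1; case: (psi x) => u v /= -> ->.
Qed.

Let N_gt1 : (1 < N)%N.
Proof. by rewrite -cardF finNzRing_gt1. Qed.

Let N_gt0 : (0 < N)%N := ltnW N_gt1.

(** A frequency below N has at most one digit, so only the first digit of [x] enters; for k = 0 the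
    product is empty and mu(0) = 0. *)
Lemma wal1E k c x : (k < N)%N -> (c < N)%N -> c%:R <= x * N%:R < c.+1%:R ->
  toC (wal1 N psi phi mu k x) = psiC (mu k * phi c).
Proof.
move=> kN cN /andP[cx xc]; rewrite /wal1 /ndigits.
have [->|k0] := posnP k.
  by rewrite up_log1 big_geq // mu0 mul0r psiC0.
have -> : up_log N k.+1 = 1%N by apply: up_log_eq => //; rewrite expn1 ltnS k0.
rewrite big_ltn // big_geq // toCM mulr1 /kdigit expn0 divn1 modn_small // /xdigit.
rewrite RpowE expr1 INRE -(@Int_part_spec (x * N%:R) (Z.of_nat c)).
  by rewrite Nat2Z.id modn_small.
rewrite -INR_IZR_INZ INRE; split; last exact/RleP.
by apply/RltP; rewrite RminusE ltrBlDr; move: xc; rewrite -natr1.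
Qed.

Lemma walshE (k c : {ffun 'I_s -> 'I_N}) x : in_cell c x ->
  toC (walsh N psi phi mu (fun j => k j) x) = psiC (digit_dot phi mu k c).
Proof.
move=> /forallP cx; rewrite /walsh (big_morph toC toCM (erefl : toC Defs.C1 = 1)).
rewrite /digit_dot (psi_sum psiCD psiC0); apply: eq_bigr => j _.
exact: wal1E.
Qed.

Lemma sum_Complex (I : finType) (f g : I -> R) :
  \sum_i (f i +i* g i) = (\sum_i f i) +i* (\sum_i g i).
Proof. by elim/big_rec3: _ => // i x y z _ ->. Qed.

Let A := walsh_partial_sum N psi phi mu h N.
Let omega := holder_modulus N psi phi mu alpha p h.

(** With X and Y the two arguments of the maximum, the step function of cell means has error at most
    X A, and replacing [h] by it on the point set costs at most (1 - A) Y. As A lies in [0, 1], the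
    total is at most max(X, Y). *)
Theorem quadrature_bound :
  `|integral h - qmc N b phi phiinv h| <=
  Num.max ((b%:R * (s%:R - 1) + 1) / ((b%:R - 1) * Num.sqrt N%:R))
          (s_pow p alpha s / Rpower N%:R alpha).
Proof.
have cubeE (x : 'I_s -> R) : cube x -> in_unit_cube x.
  by move=> xc j; have /andP[/RleP ? /RltP ?] := xc j.
have [J [J1 J2]] : exists J : {ffun 'I_s -> 'I_N} -> R,
  (forall a, `|J a - h (grid_point a) / N%:R ^+ s| <= omega N / N%:R ^+ s) /\
  forall (W : {ffun 'I_s -> 'I_N} -> R) (w : ('I_s -> R) -> R),
    (forall x a, cube x -> in_cell a x -> w x = W a) ->
    integral (fun x => h x * w x) = \sum_a W a * J a.
  apply: cell_integrals => //.
    move=> e /RltP /(holder_modulus_cv alpha_gt0 p_ok s_gt0 hW) [M HM].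
    by exists M => M' /HM /RleP.
  move=> M x y M0 /cubeE xc /cubeE yc xy; rewrite -RabsE; apply/RleP.
  apply: (holder_modulusP alpha_gt0 p_ok s_gt0 hW) => // j; apply/RleP.
  by rewrite RabsE INRE; apply: xy.
(* Both parts of wal_k are constant on cells, so the Walsh coefficient is a finite sum over [J];
   conjugation is inversion because psi has modulus 1. *)
have coefE k : `|dual_coef psiC phi mu (fun a => (J a)%:C) k|
    = (walsh_coef_abs N psi phi mu h (fun j => k j))%:C.
  rewrite /walsh_coef_abs.
  rewrite (J2 (fun a => complex.Re (psiC (digit_dot phi mu k a)))); last first.
    by move=> x a _ ax; rewrite -(walshE k ax).
  rewrite [X in integral X](_ : _ = fun x => h x * - (walsh N psi phi mu (fun j => k j) x).2); last first.
    by apply: functional_extensionality => x; rewrite mulrN.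
  rewrite (J2 (fun a => - complex.Im (psiC (digit_dot phi mu k a)))); last first.
    by move=> x a _ ax; rewrite -(walshE k ax).
  rewrite RsqrtE normc_def; congr (Num.sqrt _)%:C.
  have -> : dual_coef psiC phi mu (fun a => (J a)%:C) k =
      (\sum_a complex.Re (psiC (digit_dot phi mu k a)) * J a)
      +i* (\sum_a - complex.Im (psiC (digit_dot phi mu k a)) * J a).
    rewrite -sum_Complex; apply: eq_bigr => a _; rewrite psiN // invc_norm.
    rewrite (normr_psi psiCD psiC0) expr1n invr1 mul1r.
    case: (psiC _) => u v /=; apply/eqP; rewrite eq_complex /=.
    by apply/andP; split; apply/eqP; ring.
  by rewrite /= !expr2.
have E0 : integral h = \sum_a J a.
  transitivity (integral (fun x => h x * 1)).
    by congr integral; apply: functional_extensionality => x; rewrite mulr1.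
  by rewrite (J2 (fun=> 1)) //; apply: eq_bigr => a _; rewrite mul1r.
pose pts (n : 'I_N) : {ffun 'I_s -> 'I_N} :=
  [ffun j : 'I_s => Ordinal (phiinvK (phi n ^+ cexp b j)).1].
have ptsE (n : 'I_N) : zpoint N b phi phiinv (s:=s) n = grid_point (pts n).
  apply: functional_extensionality => j.
  by rewrite /zpoint /grid_point RdivE !INRE ffunE.
set X := (X in Num.max X _); set Y := (Y in Num.max _ Y).
have NR : 0 < N%:R :> R by rewrite ltr0n.
have bR : 0 < b%:R - 1 :> R by rewrite subr_gt0 ltr1n prime_gt1.
have sN : 0 < Num.sqrt N%:R :> R by rewrite sqrtr_gt0.
have X0 : 0 <= X.
  apply: divr_ge0; last by apply: mulr_ge0; apply: ltW.
  by rewrite addr_ge0 // mulr_ge0 ?ler0n // subr_ge0 ler1n.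
have E1 : `|\sum_a J a - (\sum_n N%:R ^+ s * J (pts n)) / N%:R| <= X * A.
  have phi_inj n1 n2 : (n1 < N)%N -> (n2 < N)%N -> phi n1 = phi n2 -> n1 = n2.
    by move=> h1 h2 E; rewrite -(phiK h1) -(phiK h2) E.
  have XC0 : 0 <= X%:C by rewrite ler0c.
  have HX (k : {ffun 'I_s -> 'I_N}) : (exists j, k j != 0 :> nat) ->
      `|\sum_n psiC (digit_dot phi mu k (pts n))| <= N%:R * X%:C.
    move=> [j kj]; have muk : mu (k j) != 0.
      by apply: contraNneq kj; rewrite -mu0 => /mu_inj -> //; rewrite ltn_ord.
    (* At the n-th point the argument of psi is \sum_j mu(k_j) y^([cexp b j]) with y = phi(n), and y
       runs over F. *)
    have := monomial_sum_bound b_prime cardF psiCD psiC0 psiC_nontriv (c := fun j => mu (k j)) (ex_intro _ j muk).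
    rewrite (reindex (fun i : 'I_N => phi i)) /=; last first.
      by apply: onW_bij; apply: (ord_bij cardF phi_inj).
    rewrite (eq_bigr (fun n => psiC (digit_dot phi mu k (pts n)))); last first.
      move=> n _; congr psiC; apply: eq_bigr => i _; rewrite ffunE /=.
      by rewrite (phiinvK _).2.
    move=> /le_trans; apply; rewrite -(rmorph_nat (real_complex R)) -rmorphM lecR /X.
    rewrite -{2}(sqr_sqrtr (ltW NR)) expr2 le_eqVlt; apply/orP; left; apply/eqP.
    by field; rewrite !lt0r_neq0.
  have := walsh_quadrature psiCD psiC0 psiC_nontriv N_gt0 cardF phi_inj mu_inj mu0
    (fun a => (J a)%:C) XC0 HX.
  have -> : \sum_k `|dual_coef psiC phi mu (fun a => (J a)%:C) k| = A%:C.
    by rewrite /A /walsh_partial_sum rmorph_sum; apply: eq_bigr => k _; exact: coefE.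
  have -> : \sum_n N%:R ^+ s * (J (pts n))%:C = (\sum_n N%:R ^+ s * J (pts n))%:C.
    rewrite rmorph_sum; apply: eq_bigr => n _.
    by rewrite (rmorphM (real_complex R)) (rmorphXn (real_complex R)) rmorph_nat.
  rewrite -[X in _ / X](rmorph_nat (real_complex R)) -(rmorph_sum (real_complex R)).
  rewrite -(fmorphV (real_complex R)) -!(rmorphM (real_complex R)) -(rmorphB (real_complex R)).
  by rewrite normc_def /= expr0n /= addr0 sqrtr_sqr lecR.
have E2 : `|(\sum_n N%:R ^+ s * J (pts n)) / N%:R - qmc N b phi phiinv h| <= omega N.
  rewrite /qmc RdivE INRE -mulrBl normrM normfV normr_nat ler_pdivrMr // -sumrB.
  apply: le_trans (ler_norm_sum _ _ _) _.
  rewrite [leRHS](_ : _ = \sum_(n < N) omega N); last first.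
    by rewrite sumr_const card_ord mulr_natr.
  apply: ler_sum => n _; rewrite ptsE; have := J1 (pts n).
  have Ns : 0 < N%:R ^+ s :> R by rewrite exprn_gt0.
  rewrite ler_pdivlMr // => /(le_trans _); apply.
  have -> : `|J (pts n) - h (grid_point (pts n)) / N%:R ^+ s| * N%:R ^+ s
      = `|(J (pts n) - h (grid_point (pts n)) / N%:R ^+ s) * N%:R ^+ s|.
    by rewrite normrM [X in _ = _ * X]ger0_norm // ltW.
  by rewrite mulrBl divfK ?lt0r_neq0 // [J _ * _]mulrC.
have /= [/RleP A0 /RleP A1] := walsh_sum_le1 alpha_gt0 p_ok s_gt0 hW.
rewrite -/A in A0 A1.
have oE : omega N = (1 - A) * Y by rewrite /omega /holder_modulus RdivE INRE mulrA.
rewrite E0.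
have -> : \sum_a J a - qmc N b phi phiinv h = (\sum_a J a - (\sum_n N%:R ^+ s * J (pts n)) / N%:R)
   + ((\sum_n N%:R ^+ s * J (pts n)) / N%:R - qmc N b phi phiinv h) by rewrite addrA subrK.
apply: le_trans (ler_normD _ _) _; apply: (@le_trans _ _ (X * A + (1 - A) * Y)).
  by rewrite lerD // -oE.
set Z := Num.max X Y.
have XZ : X * A <= Z * A by rewrite ler_wpM2r // le_max lexx.
have YZ : (1 - A) * Y <= (1 - A) * Z by rewrite ler_wpM2l ?subr_ge0 // le_max lexx orbT.
have -> : Z = Z * A + (1 - A) * Z by ring.
exact: lerD.
Qed.

End Main.

Local Close Scope complex_scope.
Local Close Scope ring_scope.
Local Open Scope R_scope.

Theorem mainTheorem9 (alpha : R) (p : pexp) (b m s : nat) (F : finFieldType)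
    (psi : F -> Cplx) (phi mu : nat -> F) (phiinv : F -> nat) :
  0 < alpha <= 1 -> pexp_ok p ->
  prime b -> (1 <= m)%N -> #|F| = (b ^ m)%N ->
  (1 <= s)%N -> (s < b ^ m)%N ->
  nontrivial_additive_char psi ->
  (* phi : Z_{b^m} -> F bijection with inverse phiinv, phi 0 = 0 *)
  (forall n, (n < b ^ m)%N -> phiinv (phi n) = n) ->
  (forall y : F, (phiinv y < b ^ m)%N /\ phi (phiinv y) = y) ->
  phi 0%N = 0%R ->
  (* mu : Z_{b^m} -> F bijection, mu 0 = 0 *)
  (forall n1 n2, (n1 < b ^ m)%N -> (n2 < b ^ m)%N -> mu n1 = mu n2 -> n1 = n2) ->
  (forall y : F, exists2 n, (n < b ^ m)%N & mu n = y) ->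
  mu 0%N = 0%R ->
  (* e(W_{alpha,p}, R_{N,s}) <= bound *)
  forall h : ('I_s -> R) -> R,
    in_W_unit_ball (b ^ m) psi phi mu alpha p h ->
    Rabs (integral h - qmc (b ^ m) b phi phiinv h)
      <= Rmax ((INR b * (INR s - 1) + 1) / ((INR b - 1) * sqrt (INR (b ^ m))))
              (s_pow p alpha s / Rpower (INR (b ^ m)) alpha).
Proof.
move=> [alpha_gt0 _] p_ok b_prime _ cardF s_gt0 _ psi_char phiK phiinvK _ mu_inj _ mu0 h hW.
have /RleP := quadrature_bound alpha_gt0 p_ok b_prime cardF s_gt0 psi_char phiK phiinvK
  mu_inj mu0 hW.
by rewrite -RabsE -RmaxE -!INRE -RsqrtE -!RdivE.
Qed.
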